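(* Let $\Omega$ be a subdomain of $S^3$ or $\Omega=S^3$. The Biot-Savart operator $BS$ on $\mathrm{VF}(\Omega)$ is self-adjoint: for all $V,W\in\mathrm{VF}(\Omega)$, $$\langle BS(V),W\rangle=\langle V,BS(W)\rangle .$$
   Context: $S^3\subset\mathbf R^4$ is the unit three-sphere with the round metric, oriented so that for $A\in S^3$ and linearly independent $B,C\in T_AS^3$ the basis $(A,B,C,B\times C)$ of $\mathbf R^4$ is positively oriented; cross product and gradient are those of $S^3$, and $\nabla_y$ denotes the gradient in the variable $y$. A subdomain $\Omega$ of $S^3$ is a compact three-dimensional submanifold with piecewise smooth boundary; $\mathrm{VF}(\Omega)$ is the space of smooth vector fields on $\Omega$, with $L^2$ inner product $\langle V,W\rangle=\int_\Omega V\cdot W\,dx$. $\alpha(x,y)\in[0,\pi]$ is the geodesic distance on $S^3$; for non-antipodal $x,y$, $P_{yx}:T_xS^3\to T_yS^3$ is parallel transport along the minimal geodesic; $\phi(\alpha)=-\frac{1}{4\pi^2}(\pi-\alpha)\csc\alpha$. The Biot-Savart operator is $$BS(V)(y)=\int_\Omega P_{yx}V(x)\times\nabla_y\phi(\alpha(x,y))\,dx .$$ *)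

(* Defs.v *)
From HB Require Import structures.
From mathcomp Require Import all_boot all_order all_algebra.
From mathcomp Require Import all_classical all_reals all_analysis.
Set Implicit Arguments.
Unset Strict Implicit.
Unset Printing Implicit Defensive.
Import Order.TTheory GRing.Theory Num.Theory.
Import numFieldNormedType.Exports.
Local Open Scope classical_set_scope.
Local Open Scope ring_scope.

(** * Smoothness *)

Section Smoothness.
Context {R : realType} {U V : normedModType R}.

(* All directional derivatives of f of order <= n exist on O and are
   continuous there; on R^m this is the class C^n. *)
Fixpoint Ck (n : nat) (O : set U) (f : U -> V) : Prop :=
  match n with
  | 0 => forall x, O x -> {for x, continuous f}
  | n'.+1 => (forall x, O x -> differentiable f x) /\
             (forall v, Ck n' O (fun x => 'D_v f x))
  end.

Definition smooth_open (O : set U) (f : U -> V) : Prop :=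
  forall n, Ck n O f.

(* Smoothness on an arbitrary subset A: local extendability to smooth maps on
   open sets.  Only the values of f on A matter. *)
Definition smooth_on (A : set U) (f : U -> V) : Prop :=
  forall a, A a -> exists (O : set U) (g : U -> V),
    [/\ open O, O a, smooth_open O g & forall x, A x -> O x -> g x = f x].

End Smoothness.

Section ThreeSphere.
Context {R : realType}.

Notation R4 := ('rV[R]_4).

(** * The round three-sphere *)

(* The library norm on matrices is the sup norm, hence the Euclidean structure
   below. *)
Definition dot (u v : R4) : R := \sum_(i < 4) u 0 i * v 0 i.

Definition enorm (u : R4) : R := Num.sqrt (dot u u).

Definition S3 : set R4 := [set x | enorm x = 1].

Definition tangent (a v : R4) : Prop := dot a v = 0.

Definition tanproj (a v : R4) : R4 := v - dot a v *: a.

(* The vector of T_a S^3 with cross a b c . d = det (a, b, c, d) for every d,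
   so that (a, b, c, cross a b c) is positively oriented when b, c are
   linearly independent tangent vectors. *)
Definition cross (a b c : R4) : R4 :=
  \row_(j < 4) \det (\matrix_(i < 4)
                       nth 0 [:: a; b; c; delta_mx 0 j] i).

(* The vector of T_y S^3 that represents the differential at y of the
   restriction of f to S^3 (0 if there is none). *)
Definition is_grad (f : R4 -> R) (y g : R4) : Prop :=
  tangent y g /\
  forall c : R -> R4, (forall t, S3 (c t)) -> c 0 = y -> derivable c 0 1 ->
    is_derive (0 : R) (1 : R) (f \o c) (dot g (derive1 c 0)).

Definition grad (f : R4 -> R) (y : R4) : R4 := xget 0 [set g | is_grad f y g].

(** * Geodesic distance and parallel transport *)

(* C^1 curves on [0, 1] are restrictions of C^1 curves on the line. *)
Definition C1_path (x y : R4) (c : R -> R4) : Prop :=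
  [/\ forall t, derivable c t 1, continuous (derive1 c),
      forall t, 0 <= t <= 1 -> S3 (c t), c 0 = x & c 1 = y].

Definition path_length (c : R -> R4) : R :=
  \int[lebesgue_measure]_(t in `[0, 1]) enorm (derive1 c t).

Definition geodist (x y : R4) : R :=
  inf [set path_length c | c in [set c | C1_path x y c]].

(* The Levi-Civita derivative along a curve of S^3: tangential part of the
   derivative taken in R^4. *)
Definition covder (c X : R -> R4) (t : R) : R4 := tanproj (c t) (derive1 X t).

Definition parallel_along (c X : R -> R4) : Prop :=
  forall t, [/\ derivable X t 1, tangent (c t) (X t) & covder c X t = 0].

Definition unit_geodesic (c : R -> R4) : Prop :=
  [/\ forall t, S3 (c t), forall t, derivable c t 1,
      forall t, enorm (derive1 c t) = 1 & parallel_along c (derive1 c)].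

Definition minimal_geodesic (x y : R4) (c : R -> R4) : Prop :=
  [/\ unit_geodesic c, c 0 = x & c (geodist x y) = y].

(* P_{yx} v; meaningful when y <> - x. *)
Definition transport (y x v : R4) : R4 :=
  xget 0 [set w | exists c X : R -> R4,
    [/\ minimal_geodesic x y c, parallel_along c X,
        X 0 = v & X (geodist x y) = w]].

(** * Integration over subsets of S^3 *)

(* Inverse stereographic projection; it parametrizes S^3 minus one point. *)
Definition stereo (a b c : R) : R4 :=
  let s := a ^+ 2 + b ^+ 2 + c ^+ 2 in
  (s + 1)^-1 *: \row_(i < 4) nth 0 [:: 2 * a; 2 * b; 2 * c; s - 1] i.

Definition stereo_partial (a b c : R) (i : 'I_3) : R4 :=
  nth 0 [:: derive1 (fun t => stereo t b c) a;
            derive1 (fun t => stereo a t c) b;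
            derive1 (fun t => stereo a b t) c] i.

(* sqrt (det g_ij), for g the round metric in the above chart *)
Definition vol_density (a b c : R) : R :=
  Num.sqrt (\det (\matrix_(i < 3, j < 3)
    dot (stereo_partial a b c i) (stereo_partial a b c j))).

Definition lebesgue3 :=
  ((@lebesgue_measure R \x @lebesgue_measure R) \x @lebesgue_measure R)%E.

HB.instance Definition _ := Measure.on lebesgue3.

Definition intS3 (A : set R4) (f : R4 -> R) : R :=
  \int[lebesgue3]_(u in [set u | A (stereo u.1.1 u.1.2 u.2)])
     (f (stereo u.1.1 u.1.2 u.2) * vol_density u.1.1 u.1.2 u.2).

Definition vintS3 (A : set R4) (F : R4 -> R4) : R4 :=
  \row_(j < 4) intS3 A (fun x => F x 0 j).

(** * Subdomains *)

Definition half_space : set 'rV[R]_3 := [set u | 0 <= u 0 0].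

(* Each point of A has a relatively open neighbourhood in A that is
   homeomorphic to a relatively open subset of the half-space. *)
Definition topological_3submanifold (A : set R4) : Prop :=
  forall p, A p -> exists (O : set R4) (D : set 'rV[R]_3)
                          (f : R4 -> 'rV[R]_3) (g : 'rV[R]_3 -> R4),
    [/\ [/\ open O, O p & open D],
        {within A `&` O, continuous f} /\
          {within half_space `&` D, continuous g},
        forall x, (A `&` O) x -> (half_space `&` D) (f x) /\ g (f x) = x &
        forall u, (half_space `&` D) u -> (A `&` O) (g u) /\ f (g u) = u].

(* For a closed codimension-zero submanifold A of S^3, its boundary is its
   frontier in S^3. *)
Definition boundaryS3 (A : set R4) : set R4 := A `&` closure (S3 `\` A).

Definition square : set 'rV[R]_2 := [set p | forall i, 0 <= p 0 i <= 1].

Definition open_square : set 'rV[R]_2 := [set p | forall i, 0 < p 0 i < 1].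

(* B is a finite union of smooth parametrized patches, each an injective
   immersion in the interior of the parameter square; the patches meet each
   other only along the images of the edges.  As is usual for surfaces with
   edges, corners and conical points, a patch may degenerate on the edges of
   the square. *)
Definition piecewise_smooth_surface (B : set R4) : Prop :=
  exists (n : nat) (F : 'I_n -> 'rV[R]_2 -> R4),
    [/\ B = \bigcup_(i in [set: 'I_n]) (F i @` square),
        forall i, smooth_on square (F i),
        forall i p v, open_square p -> v != 0 -> 'D_v (F i) p != 0 &
        forall i j p q, open_square p -> square q -> F i p = F j q ->
          i = j /\ p = q].

Definition subdomain (A : set R4) : Prop :=
  [/\ A `<=` S3, compact A, topological_3submanifold A &
      piecewise_smooth_surface (boundaryS3 A)].

(** * The Biot-Savart operator *)

Definition VF (A : set R4) (V : R4 -> R4) : Prop :=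
  smooth_on A V /\ forall x, A x -> tangent x (V x).

Definition L2prod (A : set R4) (V W : R4 -> R4) : R :=
  intS3 A (fun x => dot (V x) (W x)).

Definition phi (a : R) : R := - (4 * pi ^+ 2)^-1 * ((pi - a) * (sin a)^-1).

(* The integrand is only defined for x <> y, - y, that is, off a null set. *)
Definition BS (A : set R4) (V : R4 -> R4) (y : R4) : R4 :=
  vintS3 A (fun x =>
    cross y (transport y x (V x)) (grad (fun z => phi (geodist x z)) y)).

End ThreeSphere.

(* Main.v *)
Require Import Defs.
From HB Require Import structures.
From mathcomp Require Import all_boot all_order all_algebra.
From mathcomp Require Import all_classical all_reals all_analysis.
From mathcomp Require Import measurable_realfun ring lra.
Set Implicit Arguments.
Unset Strict Implicit.
Unset Printing Implicit Defensive.
Import Order.TTheory GRing.Theory Num.Theory.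
Import numFieldNormedType.Exports.
Local Open Scope classical_set_scope.
Local Open Scope ring_scope.

(** Off the diagonal and the antidiagonal the integrand of the Biot-Savart
operator has a closed form.  Put s = <x, y>.  The geodesic distance of x and y
is acos s (geodistE), so the gradient at y of phi (geodist x .) is
kappa s (x - s y) with kappa = (phi o acos)' (grad_phi_geodist).  Parallel
transport along the minimal geodesic changes v only within the plane spanned by
x and y (transport_span), and cross y a b is alternating, so these corrections
disappear: the integrand is kappa s (cross y v x) (biot_savart_kernelE).  Paired
with w it is kappa s det (y, v, x, w).  Exchanging (x, v) with (y, w) is an even
permutation of the four columns (dot_cross_swap), so the two sides of the theorem
are the two iterated integrals of one and the same function of two points.

What remains is Fubini, that is, absolute integrability.  The cross product
contributes a factor at most const * sqrt (1 - s^2), and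
|kappa s| sqrt (1 - s^2) <= 1 / (1 - s) = 2 / |x - y|^2 (kappa_le): there is no
singularity at the antipode, and at the diagonal there is an inverse square,
integrable in dimension three.  In stereographic coordinates u, v of x, y one has
1 - s = 2 |u - v|^2 / ((1 + |u|^2) (1 + |v|^2)), and the volume density is
(2 / (1 + |u|^2))^3, so that the density of the double integral is dominated by a
constant times
(1 + |v|^2)^-2 (1 + |u|^2)^-2 |u - v|^-2.
The singularity at u = v and the decay at infinity are both controlled by
comparison with series of multiples of indicators of cubes of dyadic sizes
(wt_div_sqn_le, wt_le_far), whose integrals are geometric series.

The distance formula requires that no C^1 path on the sphere from x to y is
shorter than acos <x, y>.  The function acos <x, c t> is not differentiable where
c t = x or c t = - x, but acos (k <x, c t>) is for every k < 1, and its derivative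
is at most |c' t|; integrate and let k tend to 1.

Besides tangency, the vector fields enter only through two properties: in the
chart they are measurable, being continuous on a closed set, and they are
bounded, being continuous on a compact set. *)

(** * Euclidean and cross product algebra in dimension four *)

Section Algebra.
Context {R : realType}.
Notation R4 := ('rV[R]_4).
Implicit Types (a b c d x y z v w : R4) (t : R).

Lemma dotE x y : dot x y =
  x 0 0 * y 0 0 + x 0 1 * y 0 1 + x 0 2%:R * y 0 2%:R + x 0 3%:R * y 0 3%:R.
Proof.
rewrite /dot !big_ord_recl big_ord0 addr0 !addrA.
by do !congr (_ + _); congr (_ * _); congr (_ 0 _); apply/val_inj.
Qed.

Lemma row4P x y : [/\ x 0 0 = y 0 0, x 0 1 = y 0 1, x 0 2%:R = y 0 2%:R &
  x 0 3%:R = y 0 3%:R] -> x = y.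
Proof.
case=> h0 h1 h2 h3; apply/rowP => -[[|[|[|[|//]]]] lti].
- by rewrite (_ : Ordinal lti = 0) //; apply/val_inj.
- by rewrite (_ : Ordinal lti = 1) //; apply/val_inj.
- by rewrite (_ : Ordinal lti = 2%:R) //; apply/val_inj.
- by rewrite (_ : Ordinal lti = 3%:R) //; apply/val_inj.
Qed.

Lemma det3E (M : 'M[R]_3) : \det M =
  M 0 0 * (M 1 1 * M 2%:R 2%:R - M 1 2%:R * M 2%:R 1) -
  M 0 1 * (M 1 0 * M 2%:R 2%:R - M 1 2%:R * M 2%:R 0) +
  M 0 2%:R * (M 1 0 * M 2%:R 1 - M 1 1 * M 2%:R 0).
Proof.
pose m (i j : nat) := M (inord i) (inord j).
have mE (i j : 'I_3) : M i j = m i j by rewrite /m !inord_val.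
rewrite (expand_det_row _ 0) !big_ord_recl big_ord0 /cofactor.
rewrite !(expand_det_row _ 0) !big_ord_recl !big_ord0 /cofactor !det_mx11 !mxE.
rewrite !mE /= /bump /=.
rewrite !expr0 !expr1 /=; ring.
Qed.

Lemma crossE a b c : cross a b c = \row_(j < 4) nth 0 [::
  - (a 0 1 * (b 0 2%:R * c 0 3%:R - b 0 3%:R * c 0 2%:R)
   - a 0 2%:R * (b 0 1 * c 0 3%:R - b 0 3%:R * c 0 1)
   + a 0 3%:R * (b 0 1 * c 0 2%:R - b 0 2%:R * c 0 1));
   (a 0 0 * (b 0 2%:R * c 0 3%:R - b 0 3%:R * c 0 2%:R)
   - a 0 2%:R * (b 0 0 * c 0 3%:R - b 0 3%:R * c 0 0)
   + a 0 3%:R * (b 0 0 * c 0 2%:R - b 0 2%:R * c 0 0));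
  - (a 0 0 * (b 0 1 * c 0 3%:R - b 0 3%:R * c 0 1)
   - a 0 1 * (b 0 0 * c 0 3%:R - b 0 3%:R * c 0 0)
   + a 0 3%:R * (b 0 0 * c 0 1 - b 0 1 * c 0 0));
   (a 0 0 * (b 0 1 * c 0 2%:R - b 0 2%:R * c 0 1)
   - a 0 1 * (b 0 0 * c 0 2%:R - b 0 2%:R * c 0 0)
   + a 0 2%:R * (b 0 0 * c 0 1 - b 0 1 * c 0 0))] j.
Proof.
apply/rowP => j; rewrite !mxE (expand_det_row _ ord_max) (bigD1 j) //= big1 ?addr0; last first.
  by move=> i ij; rewrite !mxE /= (negPf ij) mul0r.
rewrite !mxE /= eqxx mul1r /cofactor det3E !mxE /=.
pose f (v : R4) (i : nat) := v 0 (inord i).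
have fE (v : R4) (i : 'I_4) : v 0 i = f v i by rewrite /f !inord_val.
rewrite !fE; case: j => [[|[|[|[|//]]]] lti]; rewrite /= /bump /= !addnE /=;
  rewrite ?exprS ?expr0; ring.
Qed.

(** For measurability: the coordinates of a cross product are polynomials in
the coordinates of its arguments. *)
Lemma cross_coord_closed (T : Type) (P : (T -> R) -> Prop) (a b c : T -> R4) j :
  (forall f g, P f -> P g -> P (fun p => f p + g p)) ->
  (forall f, P f -> P (fun p => - f p)) ->
  (forall f g, P f -> P g -> P (fun p => f p * g p)) ->
  (forall i, P (fun p => a p 0 i)) -> (forall i, P (fun p => b p 0 i)) ->
  (forall i, P (fun p => c p 0 i)) ->
  P (fun p => cross (a p) (b p) (c p) 0 j).
Proof.
move=> add opp mul Pa Pb Pc.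
under eq_fun do rewrite crossE mxE.
case: j => [[|[|[|[|//]]]] lj] /=.
all: repeat first [exact: Pa | exact: Pb | exact: Pc | apply: (add _ _)
    | apply: (opp _) | apply: (mul _ _)].
Qed.

Lemma dotC x y : dot x y = dot y x.
Proof. by rewrite !dotE; ring. Qed.

Lemma dotDr x y z : dot x (y + z) = dot x y + dot x z.
Proof. by rewrite !dotE !mxE; ring. Qed.

Lemma dotZr t x y : dot x (t *: y) = t * dot x y.
Proof. by rewrite !dotE !mxE; ring. Qed.

Lemma dotNr x y : dot x (- y) = - dot x y.
Proof. by rewrite !dotE !mxE; ring. Qed.

Lemma dot0r x : dot x 0 = 0.
Proof. by rewrite !dotE !mxE; ring. Qed.

Lemma dotDl x y z : dot (x + y) z = dot x z + dot y z.
Proof. by rewrite !dotE !mxE; ring. Qed.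

Lemma dotZl t x y : dot (t *: x) y = t * dot x y.
Proof. by rewrite !dotE !mxE; ring. Qed.

Lemma dotNl x y : dot (- x) y = - dot x y.
Proof. by rewrite !dotE !mxE; ring. Qed.

Definition dot_lin := (dotDl, dotDr, dotZl, dotZr, dotNl, dotNr).

Lemma dot_ge0 x : 0 <= dot x x.
Proof. by apply: sumr_ge0 => i _; rewrite -expr2 sqr_ge0. Qed.

Lemma dot_eq0 x : dot x x = 0 -> x = 0.
Proof.
move/eqP; rewrite psumr_eq0; last by move=> i _; rewrite -expr2 sqr_ge0.
move/allP => h; apply/rowP => i; rewrite mxE.
by have := h i (mem_index_enum _); rewrite /= mulf_eq0 orbb => /eqP.
Qed.

Lemma S3E x : S3 x <-> dot x x = 1.
Proof.
rewrite /S3 /enorm /=; split => [h|->]; last by rewrite sqrtr1.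
by rewrite -[LHS]sqr_sqrtr ?dot_ge0// h expr1n.
Qed.

Lemma dot_CauchySchwarz x y : dot x y ^+ 2 <= dot x x * dot y y.
Proof.
rewrite -subr_ge0 !dotE.
set a0 := x 0 0; set a1 := x 0 1; set a2 := x 0 _; set a3 := x 0 _.
set b0 := y 0 0; set b1 := y 0 1; set b2 := y 0 _; set b3 := y 0 _.
rewrite (_ : _ - _ = (a0 * b1 - a1 * b0) ^+ 2 + (a0 * b2 - a2 * b0) ^+ 2 +
  (a0 * b3 - a3 * b0) ^+ 2 + (a1 * b2 - a2 * b1) ^+ 2 +
  (a1 * b3 - a3 * b1) ^+ 2 + (a2 * b3 - a3 * b2) ^+ 2); last by ring.
by rewrite !addr_ge0 ?sqr_ge0.
Qed.

Lemma coord_sqr_le x i : x 0 i ^+ 2 <= dot x x.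
Proof.
rewrite /dot (bigD1 i) //= -expr2 lerDl sumr_ge0 // => j _.
by rewrite -expr2 sqr_ge0.
Qed.

Lemma dot_S3_itv x y : S3 x -> S3 y -> -1 <= dot x y <= 1.
Proof.
move=> /S3E xx /S3E yy; have := dot_CauchySchwarz x y.
by rewrite xx yy mulr1 => h; apply/andP; split; nra.
Qed.

Lemma dot_S3_itvoo x y : S3 x -> S3 y -> x <> y -> x <> - y -> -1 < dot x y < 1.
Proof.
move=> Sx Sy nxy nxNy; have /andP[h1 h2] := dot_S3_itv Sx Sy.
move: Sx Sy => /S3E xx /S3E yy.
rewrite !lt_neqAle h1 h2 !andbT; apply/andP; split; apply/eqP => e.
  apply: nxNy; apply/eqP; rewrite -subr_eq0 opprK; apply/eqP/dot_eq0.
  by rewrite !dot_lin xx yy (dotC y x) -e; ring.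
apply: nxy; apply/eqP; rewrite -subr_eq0; apply/eqP/dot_eq0.
by rewrite !dot_lin xx yy (dotC y x) e; ring.
Qed.

(** Transport and gradient are explicit only up to multiples of x and y; here
those multiples drop out. *)
Lemma cross_mod_span x y v (a b k s : R) :
  cross y (v + a *: x + b *: y) (k *: (x - s *: y)) = k *: cross y v x.
Proof. by rewrite !crossE; apply: row4P; split; rewrite !mxE /=; ring. Qed.

Lemma cross_project x y v (s : R) : cross y v x = cross y v (x - s *: y).
Proof. by rewrite !crossE; apply: row4P; split; rewrite !mxE /=; ring. Qed.

(** Both sides are the determinant of the same four vectors, in orders that
differ by the even permutation (y, v, x, w) -> (x, w, y, v). *)
Lemma dot_cross_swap x y v w :
  dot (cross y v x) w = dot v (cross x w y).
Proof. by rewrite !crossE !dotE !mxE /=; ring. Qed.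

Lemma cross_coord_le (A B C : R) a b c j : 0 <= A -> 0 <= B -> 0 <= C ->
  (forall i, `|a 0 i| <= A) -> (forall i, `|b 0 i| <= B) ->
  (forall i, `|c 0 i| <= C) -> `|cross a b c 0 j| <= 6 * (A * (B * C)).
Proof.
move=> A0 B0 C0 hA hB hC.
have m2 i k l : `|a 0 i * (b 0 k * c 0 l)| <= A * (B * C).
  by rewrite !normrM !ler_pM ?mulr_ge0.
have m3 i k l k' l' :
    `|a 0 i * (b 0 k * c 0 l - b 0 k' * c 0 l')| <= 2 * (A * (B * C)).
  rewrite mulrBr (le_trans (ler_normB _ _))// mulr_natl mulr2n.
  by apply: lerD; exact: m2.
have m6 u1 u2 u3 : `|u1| <= 2 * (A * (B * C)) -> `|u2| <= 2 * (A * (B * C)) ->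
    `|u3| <= 2 * (A * (B * C)) -> `|u1 - u2 + u3| <= 6 * (A * (B * C)).
  move=> h1 h2 h3; apply: le_trans (ler_normD _ _) _.
  have : `|u1 - u2| <= `|u1| + `|u2| by rewrite ler_normB.
  lra.
rewrite crossE mxE; case: j => [[|[|[|[|//]]]] lti] /=; rewrite ?normrN;
  by apply: m6; exact: m3.
Qed.

(** Replacing x by its projection on the tangent space at y does not change the
cross product, and that projection has norm sqrt (1 - <x, y>^2). *)
Lemma cross_coord_le_sin (M : R) x y v j : S3 x -> S3 y -> 0 <= M ->
  (forall i, `|v 0 i| <= M) ->
  `|cross y v x 0 j| <= 6 * M * Num.sqrt (1 - dot x y ^+ 2).
Proof.
move=> /S3E xx /S3E yy M0 hv; rewrite (cross_project _ _ _ (dot x y)).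
rewrite -[6 * M * _]mulrA -[M * _]mul1r.
apply: cross_coord_le => //; rewrite ?sqrtr_ge0// => i; last first.
  rewrite -sqrtr_sqr ler_sqrt; last first.
    by rewrite subr_ge0 (le_trans (dot_CauchySchwarz _ _))// xx yy mulr1.
  apply: le_trans (coord_sqr_le _ _) _; rewrite !dot_lin xx yy (dotC y x).
  by rewrite le_eqVlt; apply/orP; left; apply/eqP; ring.
by rewrite -sqrtr_sqr -[leRHS]sqrtr1 ler_sqrt// -yy coord_sqr_le.
Qed.

(** Cauchy-Schwarz for d and the part of x orthogonal to c. *)
Lemma dot_tangent_le x c d : dot x x = 1 -> dot c c = 1 -> dot c d = 0 ->
  dot x d ^+ 2 <= (1 - dot x c ^+ 2) * dot d d.
Proof.
move=> xx cc cd; have := dot_CauchySchwarz (x - dot x c *: c) d.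
rewrite !dot_lin cd xx cc (dotC c x) mulr0 subr0.
by congr (_ <= _ * _); ring.
Qed.

End Algebra.

(** * Calculus of curves in Euclidean four-space *)

Section CurveCalculus.
Context {R : realType}.
Notation R4 := ('rV[R]_4).
Implicit Types (c d : R -> R4) (f g : R -> R) (t : R).

Lemma is_derive_row4P c t (c' : R4) :
  is_derive t (1 : R) c c' <->
  forall i, is_derive t (1 : R) (fun s => c s 0 i) (c' 0 i).
Proof.
split=> [[dc <-] i|h].
  apply: DeriveDef; first by move/derivable_mxP : dc; exact.
  by rewrite derive_mx// mxE.
have dc : derivable c t 1.
  by apply/derivable_mxP => i j; rewrite (ord1 i); exact: ex_derive.
apply: DeriveDef => //; rewrite derive_mx//.
by apply/rowP => i; rewrite mxE derive_val.
Qed.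

Lemma derivable_is_derive c t : derivable c t 1 -> is_derive t 1 c (derive1 c t).
Proof. by move=> dc; rewrite derive1E; exact: derivableP. Qed.

Lemma is_derive1E c t (c' : R4) : is_derive t (1 : R) c c' -> derive1 c t = c'.
Proof. by move=> dc; rewrite derive1E derive_val. Qed.

Lemma is_derive_mulfun f g t (df dg : R) :
  is_derive t (1 : R) f df -> is_derive t (1 : R) g dg ->
  is_derive t (1 : R) (fun s => f s * g s) (df * g t + f t * dg).
Proof.
move=> hf hg; have h := is_deriveM hf hg.
by apply: is_derive_eq h _; rewrite /GRing.scale /=; ring.
Qed.

Lemma is_derive_dot c d t (c' d' : R4) :
  is_derive t (1 : R) c c' -> is_derive t (1 : R) d d' ->
  is_derive t (1 : R) (fun s => dot (c s) (d s)) (dot c' (d t) + dot (c t) d').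
Proof.
move=> /is_derive_row4P hc /is_derive_row4P hd; rewrite /dot -big_split /=.
rewrite (_ : (fun _ => _) = \sum_(i < 4) (fun s => c s 0 i * d s 0 i)); last first.
  by apply/funext => s; rewrite fct_sumE.
by apply: is_derive_sum => i; exact: is_derive_mulfun.
Qed.

Lemma is_derive_scale f c t (df : R) (c' : R4) :
  is_derive t (1 : R) f df -> is_derive t (1 : R) c c' ->
  is_derive t (1 : R) (fun s => f s *: c s) (df *: c t + f t *: c').
Proof.
move=> hf /is_derive_row4P hc; apply/is_derive_row4P => i; rewrite !mxE.
rewrite (_ : (fun _ => _) = (fun s => f s * c s 0 i)); last first.
  by apply/funext => s; rewrite mxE.
exact: is_derive_mulfun.
Qed.

Lemma is_derive_addfun c d t (c' d' : R4) :
  is_derive t (1 : R) c c' -> is_derive t (1 : R) d d' ->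
  is_derive t (1 : R) (fun s => c s + d s) (c' + d').
Proof. by move=> hc hd; exact: (is_deriveD hc hd). Qed.

Lemma is_derive_subfun c d t (c' d' : R4) :
  is_derive t (1 : R) c c' -> is_derive t (1 : R) d d' ->
  is_derive t (1 : R) (fun s => c s - d s) (c' - d').
Proof. by move=> hc hd; exact: (is_deriveB hc hd). Qed.

Lemma is_derive_cstfun (v : R4) t : is_derive t (1 : R) (fun=> v) 0.
Proof. exact: is_derive_cst. Qed.

Lemma is_derive_compfun f g t (df dg : R) :
  is_derive (f t) (1 : R) g dg -> is_derive t (1 : R) f df ->
  is_derive t (1 : R) (fun s => g (f s)) (dg * df).
Proof. exact: is_derive1_comp. Qed.

Lemma derive_0_cst_row4 c : (forall t, is_derive t (1 : R) c 0) ->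
  forall s t, c s = c t.
Proof.
move=> h s t; apply/rowP => i.
have hi u : is_derive u (1 : R) (fun s => c s 0 i) 0.
  by have /is_derive_row4P/(_ i) := h u; rewrite mxE.
exact: (is_derive_0_is_cst s t hi).
Qed.

Lemma is_derive_continuous c t (c' : R4) : is_derive t (1 : R) c c' ->
  {for t, continuous c}.
Proof.
by move=> h; apply/differentiable_continuous/derivable1_diffP; exact: ex_derive.
Qed.

Lemma is_derive_continuousR f t (f' : R) : is_derive t (1 : R) f f' ->
  {for t, continuous f}.
Proof.
by move=> h; apply/differentiable_continuous/derivable1_diffP; exact: ex_derive.
Qed.

Lemma continuous_dot {T : topologicalType} (c d : T -> R4) (t : T) :
  {for t, continuous c} -> {for t, continuous d} ->
  {for t, continuous (fun s => dot (c s) (d s))}.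
Proof.
move=> hc hd.
have h (e : T -> R4) i : {for t, continuous e} ->
    {for t, continuous (fun s => e s 0 i)}.
  move=> he; exact: (continuous_comp he (@coord_continuous R 1 4 0 i _)).
rewrite (_ : (fun _ => _) = (fun s => c s 0 0 * d s 0 0 + c s 0 1 * d s 0 1 +
    c s 0 2%:R * d s 0 2%:R + c s 0 3%:R * d s 0 3%:R)); last first.
  by apply/funext => s; rewrite dotE.
by do !apply: continuousD; apply: continuousM; exact: h.
Qed.

(** For orthonormal x and e, the unit speed great circle through x with
initial velocity e; its derivative is the great circle of e and - x. *)
Definition gcircle (x e : R4) (t : R) : R4 := cos t *: x + sin t *: e.

Lemma is_derive_gcircle (x e : R4) t :
  is_derive t (1 : R) (gcircle x e) (gcircle e (- x) t).
Proof.
have h := is_derive_addfun (is_derive_scale (is_derive_cos t) (is_derive_cstfun x t))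
  (is_derive_scale (is_derive_sin t) (is_derive_cstfun e t)).
apply: is_derive_eq h _; rewrite /gcircle !scaler0 !addr0 scalerN scaleNr.
by rewrite addrC.
Qed.

Lemma derive1_gcircle (x e : R4) : derive1 (gcircle x e) = gcircle e (- x).
Proof. by apply/funext => t; apply: is_derive1E; exact: is_derive_gcircle. Qed.

Lemma derivable_gcircle (x e : R4) t : derivable (gcircle x e) t 1.
Proof. by have := is_derive_gcircle x e t; case. Qed.

Lemma gcircle0 (x e : R4) : gcircle x e 0 = x.
Proof. by rewrite /gcircle cos0 sin0 scale1r scale0r addr0. Qed.

Lemma dot_gcircle (x e : R4) t : dot x x = 1 -> dot e e = 1 -> dot x e = 0 ->
  dot (gcircle x e t) (gcircle x e t) = 1.
Proof.
move=> xx ee xe; rewrite /gcircle !dot_lin xx ee (dotC e x) xe.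
by rewrite !mulr0 addr0 add0r !mulr1 -!expr2 cos2Dsin2.
Qed.

End CurveCalculus.

(** * Geodesic distance *)

Section GeodesicDistance.
Context {R : realType}.
Notation R4 := ('rV[R]_4).
Implicit Types (c d : R -> R4) (f g : R -> R) (t : R) (x y : R4).
Notation mu := (@lebesgue_measure R).

(** The factor k < 1 keeps the argument of acos inside the open interval
where it is differentiable.  The derivative of t |-> acos (k <x, c t>) is at
most |c' t| because k^2 (1 - <x, c>^2) <= 1 - k^2 <x, c>^2. *)
Lemma acos_path_le x y c (k : R) : S3 x -> C1_path x y c -> 0 < k < 1 ->
  acos (k * dot x y) - acos k <= path_length c.
Proof.
move=> Sx [dc cc Sc c0 c1] /andP[k0 k1].
pose th t := acos (k * dot x (c t)).
pose den t := Num.sqrt (1 - (k * dot x (c t)) ^+ 2).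
pose th' t := - (den t)^-1 * (k * dot x (derive1 c t)).
have kin t : 0 <= t <= 1 -> -1 < k * dot x (c t) < 1.
  move=> /Sc Sct; have /andP[h1 h2] := dot_S3_itv Sx Sct.
  by apply/andP; split; nra.
have dth t : 0 <= t <= 1 -> is_derive t (1 : R) th (th' t).
  move=> t01; apply: (is_derive_compfun (f := fun s => k * dot x (c s))).
    exact: is_derive1_acos (kin _ t01).
  have h1 := is_derive_dot (is_derive_cstfun x t) (derivable_is_derive (dc t)).
  have h := is_derive_mulfun (is_derive_cst k t 1) h1.
  by apply: is_derive_eq h _; rewrite mul0r add0r dotC dot0r add0r.
have ctc t : {for t, continuous c}.
  exact: is_derive_continuous (derivable_is_derive (dc t)).
have cth' : {within `[0, 1], continuous th'}.
  apply: continuous_in_subspaceT => t; rewrite inE /= in_itv /= => t01.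
  have cd : {for t, continuous (fun s => k * dot x (c s))}.
    apply: continuousM; first exact: cst_continuous.
    by apply: continuous_dot => //; exact: cst_continuous.
  apply: (@continuousM _ _ (fun s => - (den s)^-1)
    (fun s => k * dot x (derive1 c s))); last first.
    apply: continuousM; first exact: cst_continuous.
    by apply: continuous_dot; [exact: cst_continuous|exact: cc].
  apply: (@continuousN _ _ _ (fun s => (den s)^-1)); apply: continuousV.
    rewrite gt_eqF// sqrtr_gt0 subr_gt0.
    by have /andP[h1 h2] := kin _ t01; nra.
  apply: (continuous_comp (f := fun s => 1 - (k * dot x (c s)) ^+ 2));
    last exact: sqrt_continuous.
  apply: continuousB; first exact: cst_continuous.
  by apply: (continuous_comp (g := fun u : R => u ^+ 2) cd); exact: exprn_continuous.
have cth t : 0 <= t <= 1 -> {for t, continuous th}.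
  by move=> /dth/is_derive_continuousR.
have FTC := @continuous_FTC2 R th' th 0 1 ltr01 cth'.
have {}FTC : (\int[mu]_(t in `[0%R, 1%R]) (th' t)%:E = (th 1)%:E - (th 0)%:E)%E.
  apply: FTC; last first.
    move=> t /[!in_itv]/= /andP[t0 t1]; rewrite derive1E.
    by have [] := dth t _; rewrite ?(ltW t0) ?(ltW t1).
  split.
  - move=> t /[!in_itv]/= /andP[t0 t1].
    by have [] := dth t _; rewrite ?(ltW t0) ?(ltW t1).
  - by apply: cvg_at_right_filter; apply: cth; rewrite lexx ler01.
  - by apply: cvg_at_left_filter; apply: cth; rewrite lexx ler01.
have -> : acos (k * dot x y) - acos k = \int[mu]_(t in `[0%R, 1%R]) th' t.
  rewrite /Rintegral FTC /th c0 c1; move/S3E : Sx => ->.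
  by rewrite mulr1.
have cn : {within `[0, 1], continuous (fun t => enorm (derive1 c t))}.
  apply: continuous_subspaceT => t.
  apply: (continuous_comp (f := fun s => dot (derive1 c s) (derive1 c s)));
    last exact: sqrt_continuous.
  by apply: continuous_dot; exact: cc.
have ith' := continuous_compact_integrable (@segment_compact _ 0 1) cth'.
have inn := continuous_compact_integrable (@segment_compact _ 0 1) cn.
have sub : `]0%R, 1%R[ `<=` (`[0%R, 1%R] : set R) by exact: subset_itv_oo_cc.
have sub2 : `[0%R, 1%R[ `<=` (`[0%R, 1%R] : set R).
  by move=> u /=; rewrite !in_itv /= => /andP[-> /ltW->].
rewrite /path_length.
have iS (D : set R) (h : R -> R) : measurable D -> D `<=` `[0%R, 1%R] ->
    mu.-integrable `[0%R, 1%R] (EFin \o h) -> mu.-integrable D (EFin \o h).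
  by move=> mD DS; apply: integrableS.
have io (h : R -> R) : mu.-integrable `[0%R, 1%R] (EFin \o h) ->
   \int[mu]_(t in `[0%R, 1%R]) h t = \int[mu]_(t in `]0%R, 1%R[) h t.
  move=> ih; rewrite -Rintegral_itv_bndo_bndc; last exact: iS ih.
  by rewrite -Rintegral_itv_obnd_cbnd//; exact: iS ih.
(* The path is on the sphere, hence orthogonal to its velocity, at interior
   times only. *)
rewrite (io _ ith') (io _ inn); apply: le_Rintegral => //.
- exact: iS ith'.
- exact: iS inn.
move=> t /=; rewrite in_itv /= => t01.
have t01' : 0 <= t <= 1 by case/andP: t01 => /ltW-> /ltW->.
have ccd : dot (c t) (derive1 c t) = 0.
  have h1 := is_derive_dot (derivable_is_derive (dc t)) (derivable_is_derive (dc t)).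
  have h2 : is_derive t (1 : R) (fun s => dot (c s) (c s)) 0.
    apply: near_eq_is_derive (is_derive_cst (1 : R) t 1).
    have : \forall s \near t, s \in `]0%R, 1%R[ by exact: near_in_itvoo.
    apply: filterS => s; rewrite in_itv /= => /andP[s0 s1].
    by apply/esym/S3E/Sc; rewrite (ltW s0) (ltW s1).
  have := @derive_val _ _ _ _ _ _ _ h1; rewrite (@derive_val _ _ _ _ _ _ _ h2).
  by rewrite (dotC (derive1 c t)) => /eqP; rewrite eq_sym -mulr2n mulrn_eq0 /= => /eqP.
have xx : dot x x = 1 by apply/S3E.
have ct1 : dot (c t) (c t) = 1 by apply/S3E/Sc.
have CS := dot_tangent_le xx ct1 ccd.
apply: le_trans (ler_norm _) _.
have den0 : 0 < den t.
  rewrite sqrtr_gt0 subr_gt0.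
  by have /andP[h1 h2] := kin _ t01'; nra.
rewrite normrM normrN normfV (gtr0_norm den0) mulrC ler_pdivrMr//.
rewrite /enorm /den -sqrtrM ?dot_ge0// -sqrtr_sqr ler_sqrt; last first.
  by apply: mulr_ge0; [exact: dot_ge0|rewrite subr_ge0; have /andP[h1 h2] := kin _ t01'; nra].
have := dot_ge0 (derive1 c t).
move: CS; set A := dot x _; set B := dot x (c t); set C := dot _ _ => CS C0.
have : (k * A) ^+ 2 <= k ^+ 2 * ((1 - B ^+ 2) * C).
  by rewrite exprMn ler_pM2l ?exprn_gt0.
have : k ^+ 2 * ((1 - B ^+ 2) * C) <= C * (1 - (k * B) ^+ 2).
  rewrite -subr_ge0.
  rewrite (_ : _ - _ = C * (1 - k ^+ 2)); last by ring.
  by apply: mulr_ge0 => //; nra.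
lra.
Qed.

(** Take k = cos e in acos_path_le, where acos k = e, and let e -> 0;
with this choice of k the limit rests on the continuity of acos at the
interior point <x, y>. *)
Lemma acos_dot_path_le x y c : S3 x -> -1 < dot x y < 1 -> C1_path x y c ->
  acos (dot x y) <= path_length c.
Proof.
move=> Sx xy Cc; set s := dot x y in xy *.
have h : (acos (cos e * s) - e) @[e --> (0 : R)^'+] --> acos s - 0.
  apply: cvgB; last by apply: cvg_at_right_filter; exact: cvg_id.
  apply: cvg_at_right_filter.
  have -> : acos s = acos (cos 0 * s) by rewrite cos0 mul1r.
  apply: (continuous_comp (f := fun e => cos e * s)); last first.
    by apply: continuous_acos; rewrite cos0 mul1r.
  by apply: continuousM; [exact: continuous_cos|exact: cst_continuous].
rewrite subr0 in h; apply: (cvgr_to_le h).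
have p0 : 0 < pi / 2 :> R by rewrite divr_gt0 ?pi_gt0.
have p2 : pi / 2 <= pi :> R by rewrite ler_pdivrMr// ler_pMr ?pi_gt0// ler1n.
near=> e.
have e0 : 0 < e by near: e; exact: nbhs_right_gt.
have e1 : e < pi / 2 by near: e; exact: nbhs_right_lt.
have -> : e = acos (cos e) by rewrite cosK// in_itv /= (ltW e0)/= (le_trans (ltW e1)).
rewrite acosK; last by rewrite in_itv /= cos_geN1 cos_le1.
apply: acos_path_le => //; apply/andP; split.
  by apply: cos_gt0_pihalf; rewrite e1 andbT (lt_trans _ e0)// oppr_lt0.
rewrite -cos0 ltr_cos// in_itv /= ?lexx ?pi_ge0// (ltW e0)/=.
by rewrite (le_trans (ltW e1)).
Unshelve. all: by end_near. Qed.

(** The initial velocity of the unit speed minimal geodesic from x to y. *)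
Definition direction x y : R4 :=
  (Num.sqrt (1 - dot x y ^+ 2))^-1 *: (y - dot x y *: x).

Lemma sqrt_1Bsqr_gt0 (s : R) : -1 < s < 1 -> 0 < Num.sqrt (1 - s ^+ 2).
Proof. by move=> /andP[h1 h2]; rewrite sqrtr_gt0; nra. Qed.

Lemma directionP x y : S3 x -> S3 y -> -1 < dot x y < 1 ->
  [/\ dot x (direction x y) = 0, dot (direction x y) (direction x y) = 1 &
      gcircle x (direction x y) (acos (dot x y)) = y].
Proof.
move=> /S3E xx /S3E yy hs; rewrite /direction /gcircle.
have w0 := sqrt_1Bsqr_gt0 hs; set w := Num.sqrt _ in w0 *.
have w2 : w ^+ 2 = 1 - dot x y ^+ 2.
  by rewrite sqr_sqrtr//; case/andP: hs => h1 h2; nra.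
have hs' : -1 <= dot x y <= 1 by case/andP: hs => /ltW-> /ltW->.
split.
- by rewrite !dot_lin xx; ring.
- rewrite !dot_lin xx yy (dotC y x).
  apply: (@mulfI _ (w ^+ 2)); first by rewrite expf_neq0// gt_eqF.
  by rewrite [in RHS]w2; field; rewrite gt_eqF.
- rewrite sin_acos// -/w acosK; last by rewrite in_itv.
  rewrite scalerA mulfV ?gt_eqF// scale1r; by rewrite addrC subrK.
Qed.

Lemma is_derive_gcircle_scaled x e (a t : R) :
  is_derive t (1 : R) (fun s => gcircle x e (a * s)) (a *: gcircle e (- x) (a * t)).
Proof.
have ha : is_derive t (1 : R) (fun s => a * s) a.
  have h := is_derive_mulfun (is_derive_cst a t 1) (is_derive_id t (1 : R)).
  by apply: is_derive_eq h _; rewrite mul0r add0r mulr1.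
have hc := is_derive_addfun
  (is_derive_scale (is_derive_compfun (is_derive_cos (a * t)) ha) (is_derive_cstfun x t))
  (is_derive_scale (is_derive_compfun (is_derive_sin (a * t)) ha) (is_derive_cstfun e t)).
apply: is_derive_eq hc _; rewrite /gcircle !scaler0 !addr0 scalerDr !scalerA scalerN.
by rewrite addrC mulrC; congr (_ + _); rewrite -scaleNr; congr (_ *: _); ring.
Qed.

Lemma geodistE x y : S3 x -> S3 y -> -1 < dot x y < 1 ->
  geodist x y = acos (dot x y).
Proof.
move=> Sx Sy hs.
have [xe ee gy] := directionP Sx Sy hs; set e := direction x y in xe ee gy.
set a := acos (dot x y) in gy *.
have hs' : -1 <= dot x y <= 1 by case/andP: hs => /ltW-> /ltW->.
have a0 : 0 <= a by rewrite acos_ge0.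
pose c t := gcircle x e (a * t).
have xx : dot x x = 1 by apply/S3E.
have c'E : derive1 c = fun t => a *: gcircle e (- x) (a * t).
  by apply/funext => t; apply: is_derive1E; exact: is_derive_gcircle_scaled.
have Cc : C1_path x y c.
  split.
  - by move=> t; have [] := is_derive_gcircle_scaled x e a t.
  - move=> t; rewrite c'E.
    exact: is_derive_continuous
      (is_derive_scale (is_derive_cst a t 1) (is_derive_gcircle_scaled e (- x) a t)).
  - by move=> t _; apply/S3E; exact: dot_gcircle.
  - by rewrite /c mulr0 gcircle0.
  - by rewrite /c mulr1.
have Lc : path_length c = a.
  rewrite /path_length (@eq_Rintegral _ _ _ mu _ (fun=> a)); last first.
    move=> t _; rewrite c'E /enorm dotZl dotZr dot_gcircle//; last 2 first.
      by rewrite !dot_lin xx; ring.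
      by rewrite dotNr dotC xe oppr0.
    by rewrite mulr1 -expr2 sqrtr_sqr ger0_norm.
  by rewrite Rintegral_cst//= lebesgue_measure_itv/= lte01 oppr0 adde0 mulr1.
apply/eqP; rewrite eq_le; apply/andP; split.
  apply: ge_inf; last by exists c.
  by exists a => _ [d Cd <-]; exact: acos_dot_path_le.
apply: lb_le_inf; first by exists a, c.
by move=> _ [d Cd <-]; exact: acos_dot_path_le.
Qed.

End GeodesicDistance.

(** * Geodesics and parallel transport *)

Section Transport.
Context {R : realType}.
Notation R4 := ('rV[R]_4).
Implicit Types (c d X : R -> R4) (t : R) (x y v : R4).

Lemma tangent_dot_derive c X t (c' X' : R4) : (forall s, dot (c s) (X s) = 0) ->
  is_derive t (1 : R) c c' -> is_derive t (1 : R) X X' ->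
  dot (c t) X' = - dot c' (X t).
Proof.
move=> cX dc dX; have h := is_derive_dot dc dX.
have h0 : is_derive t (1 : R) (fun s => dot (c s) (X s)) 0.
  rewrite (_ : (fun _ => _) = cst 0); first exact: is_derive_cst.
  by apply/funext => s; rewrite cX.
have := @derive_val _ _ _ _ _ _ _ h; rewrite (@derive_val _ _ _ _ _ _ _ h0).
by move/eqP; rewrite eq_sym addrC addr_eq0 => /eqP.
Qed.

(** The tangential part of the second derivative vanishes, and differentiating
<c, c'> = 0 gives its normal part <c, c''> = - |c'|^2 = - 1. *)
Lemma unit_geodesic_derive2 c t : unit_geodesic c ->
  is_derive t (1 : R) (derive1 c) (- c t).
Proof.
move=> [Sc dc c'1 pc].
have [ddc tc cov] := pc t.
have hd := derivable_is_derive ddc.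
have e : dot (c t) (derive1 (derive1 c) t) = -1.
  rewrite (@tangent_dot_derive c (derive1 c) t (derive1 c t) _ _ (derivable_is_derive (dc t)) hd).
    congr (- _); have := c'1 t; rewrite /enorm => h.
    by rewrite -[LHS]sqr_sqrtr ?dot_ge0// h expr1n.
  by move=> s; have [] := pc s.
apply: is_derive_eq hd _.
by move/eqP: cov; rewrite /covder /tanproj e scaleN1r opprK addr_eq0 => /eqP.
Qed.

(** Uniqueness for the equation c'' = - c: rotating the pair (c, c') by the
angle - t gives a constant pair. *)
Lemma unit_geodesic_gcircle c t : unit_geodesic c ->
  c t = gcircle (c 0) (derive1 c 0) t /\
  derive1 c t = gcircle (derive1 c 0) (- c 0) t.
Proof.
move=> gc; have [_ dc _ _] := gc.
have A := @derive_0_cst_row4 R (fun s => cos s *: c s - sin s *: derive1 c s).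
have B := @derive_0_cst_row4 R (fun s => sin s *: c s + cos s *: derive1 c s).
have {}A : cos t *: c t - sin t *: derive1 c t = c 0.
  rewrite (A _ t 0); first by rewrite cos0 sin0 scale1r scale0r subr0.
  move=> s; have h := is_derive_subfun
    (is_derive_scale (is_derive_cos s) (derivable_is_derive (dc s)))
    (is_derive_scale (is_derive_sin s) (unit_geodesic_derive2 s gc)).
  apply: is_derive_eq h _; apply: row4P; split; rewrite !mxE; ring.
have {}B : sin t *: c t + cos t *: derive1 c t = derive1 c 0.
  rewrite (B _ t 0); first by rewrite cos0 sin0 scale1r scale0r add0r.
  move=> s; have h := is_derive_addfun
    (is_derive_scale (is_derive_sin s) (derivable_is_derive (dc s)))
    (is_derive_scale (is_derive_cos s) (unit_geodesic_derive2 s gc)).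
  apply: is_derive_eq h _; apply: row4P; split; rewrite !mxE; ring.
rewrite /gcircle -A -B; split; apply/rowP => i; rewrite !mxE.
  transitivity ((cos t ^+ 2 + sin t ^+ 2) * c t 0 i); last by ring.
  by rewrite cos2Dsin2 mul1r.
transitivity ((cos t ^+ 2 + sin t ^+ 2) * derive1 c t 0 i); last by ring.
by rewrite cos2Dsin2 mul1r.
Qed.

Lemma minimal_geodesic_direction x y c : S3 x -> S3 y -> -1 < dot x y < 1 ->
  minimal_geodesic x y c -> derive1 c 0 = direction x y.
Proof.
move=> Sx Sy hs [gc c0 ca]; move: ca; rewrite geodistE//.
have [-> _] := unit_geodesic_gcircle (acos (dot x y)) gc; rewrite c0 /gcircle.
have hs' : -1 <= dot x y <= 1 by case/andP: hs => /ltW-> /ltW->.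
rewrite sin_acos// acosK; last by rewrite in_itv.
rewrite /direction; have w0 := sqrt_1Bsqr_gt0 hs; move: w0.
set w := Num.sqrt _ => w0; set s := dot x y; clearbody w s; move=> <-.
by rewrite addrAC subrr add0r scalerA mulVf ?gt_eqF// scale1r.
Qed.

Lemma gcircle_minimal x y : S3 x -> S3 y -> -1 < dot x y < 1 ->
  minimal_geodesic x y (gcircle x (direction x y)).
Proof.
move=> Sx Sy hs; have [xe ee gy] := directionP Sx Sy hs.
move: (direction x y) xe ee gy => e xe ee gy.
have xx : dot x x = 1 by apply/S3E.
have NN : dot (- x) (- x) = 1 by rewrite dotNl dotNr opprK.
have eN : dot e (- x) = 0 by rewrite dotNr dotC xe oppr0.
split; last 2 first.
- exact: gcircle0.
- by rewrite geodistE.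
split.
- by move=> t; apply/S3E; exact: dot_gcircle.
- exact: derivable_gcircle.
- by move=> t; rewrite derive1_gcircle /enorm dot_gcircle// sqrtr1.
move=> t; rewrite derive1_gcircle; split.
- exact: derivable_gcircle.
- rewrite /tangent /gcircle !(dotDl, dotDr, dotZl, dotZr, dotNr, dotNl).
  by rewrite (dotC e x) xx xe ee; ring.
- rewrite /covder derive1_gcircle /tanproj.
  have -> : gcircle (- x) (- e) t = - gcircle x e t.
    by rewrite /gcircle !scalerN opprD.
  by rewrite dotNr dot_gcircle// scaleN1r opprK addNr.
Qed.

(** For X parallel along a geodesic c, the number m = <X, c'> is constant and
X' = - m c = m c'', so X - m c' is constant.  Hence transport adds to v a
multiple of the change of c', which lies in the plane of x and y. *)
Lemma transport_span x y v : S3 x -> S3 y -> -1 < dot x y < 1 -> tangent x v ->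
  exists a b : R, transport y x v = v + a *: x + b *: y.
Proof.
move=> Sx Sy hs tv.
set P := [set w | exists c X : R -> R4, [/\ minimal_geodesic x y c,
  parallel_along c X, X 0 = v & X (geodist x y) = w]].
have xx : dot x x = 1 by apply/S3E.
have [xe ee gy] := directionP Sx Sy hs.
have span w : P w -> exists a b : R, w = v + a *: x + b *: y.
  move=> [c [X [mc pX X0 <-]]].
  have [gc c0 ca] := mc.
  have c'0 := minimal_geodesic_direction Sx Sy hs mc.
  have [Sc dc _ pc] := gc.
  have cX s : dot (c s) (X s) = 0 by have [] := pX s.
  have X'E s : derive1 X s = - dot (derive1 c s) (X s) *: c s.
    have [dX _ cov] := pX s.
    rewrite -(tangent_dot_derive cX (derivable_is_derive (dc s)) (derivable_is_derive dX)).
    by move/eqP: cov; rewrite /covder /tanproj subr_eq0 => /eqP.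
  have dX s : is_derive s (1 : R) X (- dot (derive1 c s) (X s) *: c s).
    by rewrite -X'E; apply: derivable_is_derive; have [] := pX s.
  pose m := dot (derive1 c 0) (X 0).
  have mE s : dot (derive1 c s) (X s) = m.
    apply: (@is_derive_0_is_cst _ (fun s => dot (derive1 c s) (X s))) => u.
    have h := is_derive_dot (unit_geodesic_derive2 u gc) (dX u).
    apply: is_derive_eq h _; rewrite dotNl cX dotZr.
    by have [_ + _] := pc u; rewrite /tangent dotC => ->; ring.
  have Y := @derive_0_cst_row4 R (fun s => X s - m *: derive1 c s) _ (geodist x y) 0.
  have {}Y : X (geodist x y) - m *: derive1 c (geodist x y) = X 0 - m *: derive1 c 0.
    apply: Y => u.
    have h := is_derive_subfun (dX u)
      (is_derive_scale (is_derive_cst m u 1) (unit_geodesic_derive2 u gc)).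
    apply: is_derive_eq h _.
    by rewrite mE scale0r add0r scalerN scaleNr subrr.
  move/eqP: Y; rewrite subr_eq X0 => /eqP ->.
  have [_ ->] := unit_geodesic_gcircle (geodist x y) gc.
  rewrite c'0 c0 /gcircle /direction.
  set k := (Num.sqrt _)^-1; set C := cos _; set S := sin _.
  exists (- m * (S + C * k * dot x y - k * dot x y)), (m * k * (C - 1)).
  by apply/rowP => i; rewrite !mxE; ring.
(* Existence of a transported vector: the same formula along the great circle. *)
rewrite /transport -/P; apply: span; apply: xgetPex.
have := gcircle_minimal Sx Sy hs.
move: (direction x y) xe ee gy => e xe ee gy me.
pose X s := v + dot v e *: (gcircle e (- x) s - e).
exists (X (geodist x y)), (gcircle x e), X; split => //.
- have dX s : is_derive s (1 : R) X (- dot v e *: gcircle x e s).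
    have h := is_derive_addfun (is_derive_cstfun v s)
      (is_derive_scale (is_derive_cst (dot v e) s 1)
        (is_derive_subfun (is_derive_gcircle e (- x) s) (is_derive_cstfun e s))).
    apply: is_derive_eq h _; rewrite scale0r !add0r subr0 scaleNr -scalerN.
    by congr (_ *: _); rewrite /gcircle !scalerN opprD.
  move=> s; split.
  + by have [] := dX s.
  + rewrite /tangent /X /gcircle; move: tv xe ee; rewrite /tangent.
    rewrite !(dotDl, dotDr, dotZl, dotZr, dotNr, dotNl) (dotC e v) (dotC e x).
    by move=> -> -> ->; rewrite xx; ring.
  + rewrite /covder (is_derive1E (dX s)) /tanproj dotZr dot_gcircle//.
    by rewrite mulr1 subrr.
- by rewrite /X gcircle0 subrr scaler0 addr0.
Qed.

End Transport.

(** * The gradient of the fundamental solution and the kernel *)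

Section Gradient.
Context {R : realType}.
Notation R4 := ('rV[R]_4).
Implicit Types (c : R -> R4) (t s : R) (x y v w g : R4).

(** The derivative of phi o acos. *)
Definition kappa s : R := - (4 * pi ^+ 2)^-1 *
  ((Num.sqrt (1 - s ^+ 2) + (pi - acos s) * s) / Num.sqrt (1 - s ^+ 2) ^+ 3).

Lemma is_derive_phi_acos s : -1 < s < 1 ->
  is_derive s (1 : R) (fun u => phi (acos u)) (kappa s).
Proof.
move=> hs; have hs' : -1 <= s <= 1 by case/andP: hs => /ltW-> /ltW->.
have w0 := sqrt_1Bsqr_gt0 hs.
have dac := is_derive1_acos hs.
have dsin := is_derive_compfun (is_derive_sin (acos s)) dac.
have sn0 : sin (acos s) != 0 by rewrite sin_acos// gt_eqF.
have dinv := is_deriveV sn0 dsin.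
have dpi : is_derive s (1 : R) (fun u : R => pi - acos u) (Num.sqrt (1 - s ^+ 2))^-1.
  apply: is_derive_eq (is_deriveB (is_derive_cst (pi : R) s 1) dac) _.
  by rewrite sub0r opprK.
have h := is_derive_mulfun (is_derive_cst (- (4 * pi ^+ 2)^-1 : R) s 1)
  (is_derive_mulfun dpi dinv).
apply: is_derive_eq h _; rewrite mul0r add0r /kappa; congr (_ * _).
rewrite sin_acos// acosK; last by rewrite in_itv.
rewrite /GRing.scale /=.
by field; rewrite gt_eqF.
Qed.

(** Test the difference of two gradients on the great circle in its own
direction. *)
Lemma is_grad_uniq (f : R4 -> R) y g1 g2 : S3 y ->
  is_grad f y g1 -> is_grad f y g2 -> g1 = g2.
Proof.
move=> Sy [t1 h1] [t2 h2]; apply/eqP; rewrite -subr_eq0; apply/eqP.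
set d := g1 - g2; case: (pselect (dot d d = 0)) => [/dot_eq0 //|/eqP dd].
have dp : 0 < dot d d by rewrite lt0r dd dot_ge0.
have n0 : 0 < enorm d by rewrite sqrtr_gt0.
have n2 : enorm d ^+ 2 = dot d d by rewrite sqr_sqrtr// ltW.
pose e := (enorm d)^-1 *: d.
have yd : dot y d = 0 by rewrite /d dotDr dotNr t1 t2 subrr.
have yy : dot y y = 1 by apply/S3E.
have ye : dot y e = 0 by rewrite /e dotZr yd mulr0.
have ee : dot e e = 1.
  by rewrite /e dotZl dotZr -n2; field; rewrite gt_eqF.
have Sc t : S3 (gcircle y e t) by apply/S3E; exact: dot_gcircle.
have k1 := h1 _ Sc (gcircle0 y e) (@derivable_gcircle R y e 0).
have k2 := h2 _ Sc (gcircle0 y e) (@derivable_gcircle R y e 0).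
have := @derive_val _ _ _ _ _ _ _ k1; rewrite (@derive_val _ _ _ _ _ _ _ k2).
rewrite derive1_gcircle gcircle0 => /eqP; rewrite eq_sym -subr_eq0 -dotNl -dotDl -/d.
by rewrite /e dotZr mulf_eq0 invr_eq0 (gt_eqF n0) (negPf dd).
Qed.

Lemma grad_phi_geodist x y : S3 x -> S3 y -> -1 < dot x y < 1 ->
  grad (fun z => phi (geodist x z)) y = kappa (dot x y) *: (x - dot x y *: y).
Proof.
move=> Sx Sy hs.
have yy : dot y y = 1 by apply/S3E.
set G := _ *: _.
have HG : is_grad (fun z => phi (geodist x z)) y G.
  split=> [|c Sc c0 dc].
    by rewrite /tangent /G !(dotDr, dotZr, dotNr) (dotC y x) yy; ring.
  have hc := derivable_is_derive dc.
  have hd := is_derive_dot (is_derive_cstfun x 0) hc.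
  have hyc : dot y (derive1 c 0) = 0.
    have h1 := is_derive_dot hc hc.
    have h2 : is_derive (0 : R) (1 : R) (fun s => dot (c s) (c s)) 0.
      rewrite (_ : (fun _ => _) = cst 1); first exact: is_derive_cst.
      by apply/funext => u; apply/S3E.
    have := @derive_val _ _ _ _ _ _ _ h1; rewrite (@derive_val _ _ _ _ _ _ _ h2).
    by rewrite (dotC (derive1 c 0)) c0 => /eqP; rewrite eq_sym -mulr2n mulrn_eq0 /= => /eqP.
  apply: (@near_eq_is_derive _ _ _ (fun t => phi (acos (dot x (c t))))).
    have cd := is_derive_continuousR hd.
    have : \forall t \near (0 : R), dot x (c t) \in `](-1), 1[%R.
      have : nbhs (dot x (c 0)) [set u : R | u \in `](-1), 1[%R].
        by rewrite c0; apply: near_in_itvoo; rewrite in_itv.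
      exact: cd.
    apply: filterS => t; rewrite in_itv /= => ht.
    by rewrite geodistE.
  have hp : is_derive (dot x (c 0)) (1 : R) (fun u => phi (acos u)) (kappa (dot x y)).
    by rewrite c0; exact: is_derive_phi_acos.
  apply: is_derive_eq (is_derive_compfun hp hd) _.
  rewrite (dotC 0) dot0r add0r /G !(dotDl, dotZl, dotNl) hyc; ring.
apply: (is_grad_uniq Sy _ HG); rewrite /grad.
by apply: (@xgetPex _ 0 [set g | is_grad (fun z => phi (geodist x z)) y g]); exists G.
Qed.

Lemma biot_savart_kernelE x y v : S3 x -> S3 y -> -1 < dot x y < 1 -> tangent x v ->
  cross y (transport y x v) (grad (fun z => phi (geodist x z)) y) =
  kappa (dot x y) *: cross y v x.
Proof.
move=> Sx Sy hs tv; have [a [b ->]] := transport_span Sx Sy hs tv.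
by rewrite grad_phi_geodist// cross_mod_span.
Qed.

(** Compare derivatives: b sin b lies between 0 and pi sin b. *)
Lemma sin_sub_mul_cos_le (b : R) : 0 <= b <= pi ->
  0 <= sin b - b * cos b <= pi * (1 - cos b).
Proof.
move=> /andP[b0 bpi].
pose p u : R := sin u - u * cos u; pose q u : R := pi * (1 - cos u) - p u.
have dp u : is_derive u (1 : R) p (u * sin u).
  have h := is_deriveB (is_derive_sin u)
    (is_derive_mulfun (is_derive_id u (1 : R)) (is_derive_cos u)).
  by apply: is_derive_eq h _; ring.
have dq u : is_derive u (1 : R) q ((pi - u) * sin u).
  have h := is_deriveB (is_derive_mulfun (is_derive_cst (pi : R) u 1)
    (is_deriveB (is_derive_cst (1 : R) u 1) (is_derive_cos u))) (dp u).
  by apply: is_derive_eq h _; rewrite mul0r add0r sub0r opprK /=; ring.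
have sn u : u \in `]0%R, pi[%R -> 0 <= sin u.
  by rewrite in_itv /= => /andP[h1 h2]; rewrite sin_ge0_pi// (ltW h1) (ltW h2).
have mono (f df : R -> R) : (forall u, is_derive u (1 : R) f (df u)) ->
    (forall u, u \in `]0%R, pi[%R -> 0 <= df u) -> f 0 <= f b.
  move=> hf df0; apply: (@ger0_derive1_ndecr _ f 0 pi) => //.
  - by move=> u hu; rewrite derive1E (@derive_val _ _ _ _ _ _ _ (hf u)) df0.
  - by apply: continuous_subspaceT => u; exact: is_derive_continuousR (hf u).
have := mono _ _ dp; have := mono _ _ dq; rewrite /q /p !sin0 !cos0 => hq hp.
apply/andP; split.
  have := hp _; rewrite mul0r subrr; apply => u hu; rewrite mulr_ge0 ?sn//.
  by move: hu; rewrite in_itv /= => /andP[/ltW].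
have := hq _; rewrite !mul0r !subrr mulr0 subr0 subr_ge0; apply => u hu.
by rewrite mulr_ge0 ?sn// subr_ge0; move: hu; rewrite in_itv /= => /andP[_ /ltW].
Qed.

(** With b = pi - acos s the numerator of kappa is sin b - b cos b, at most
pi (1 + s), so the singularity of kappa at s = - 1 is only that of
1 / sqrt (1 - s^2), which the left hand side cancels. *)
Lemma kappa_le s : -1 < s < 1 ->
  `|kappa s| * Num.sqrt (1 - s ^+ 2) <= (1 - s)^-1.
Proof.
move=> hs; have hs' : -1 <= s <= 1 by case/andP: hs => /ltW-> /ltW->.
have w0 := sqrt_1Bsqr_gt0 hs.
have w2 : Num.sqrt (1 - s ^+ 2) ^+ 2 = (1 - s) * (1 + s).
  by rewrite sqr_sqrtr; [ring|case/andP: hs => h1 h2; nra].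
have /andP[h1 h2] := hs.
have p0 : 0 < pi :> R by exact: pi_gt0.
have p1 : 1 < pi :> R by have := @pi_ge2 R; lra.
have b01 : 0 <= pi - acos s <= pi.
  by rewrite subr_ge0 acos_lepi//= lerBlDr lerDl acos_ge0.
have := sin_sub_mul_cos_le b01.
rewrite (_ : sin (pi - acos s) = Num.sqrt (1 - s ^+ 2)); last first.
  by rewrite -sin_acos// sinB sinpi cospi; ring.
rewrite (_ : cos (pi - acos s) = - s); last first.
  by rewrite cosB sinpi cospi acosK ?in_itv//=; ring.
rewrite mulrN !opprK /kappa => /andP[N0 N1].
rewrite mulNr normrN ger0_norm; last first.
  by rewrite !mulr_ge0 ?invr_ge0 ?mulr_ge0 ?exprn_ge0 ?(ltW p0)// ltW.
set N := _ + _ in N0 N1 *; move: w0 w2; set w := Num.sqrt _ => w0 w2.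
clearbody N w; clear b01; move: N0 N1 p0 p1; set p : R := pi; clearbody p => N0 N1 p0 p1.
have -> : (4 * p ^+ 2)^-1 * (N / w ^+ 3) * w = (4 * p ^+ 2)^-1 * N / ((1 - s) * (1 + s)).
  by rewrite -w2; field; rewrite ?(gt_eqF w0) ?(gt_eqF p0).
have s1 : 0 < 1 - s by lra.
have s2 : 0 < 1 + s by lra.
rewrite ler_pdivrMr ?mulr_gt0// mulKf ?gt_eqF// ler_pdivrMl ?mulr_gt0 ?exprn_gt0//.
apply: le_trans N1 _; rewrite ler_pM2r//; nra.
Qed.

End Gradient.

(** * Stereographic coordinates *)

Section Stereographic.
Context {R : realType}.
Notation R4 := ('rV[R]_4).
Implicit Types (a b c t : R).

Definition row4 (p q r s : R) : R4 := \row_(i < 4) nth 0 [:: p; q; r; s] i.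

Lemma is_derive_row4 (p q r s : R -> R) t (p' q' r' s' : R) :
  is_derive t (1 : R) p p' -> is_derive t (1 : R) q q' ->
  is_derive t (1 : R) r r' -> is_derive t (1 : R) s s' ->
  is_derive t (1 : R) (fun u => row4 (p u) (q u) (r u) (s u)) (row4 p' q' r' s').
Proof.
move=> hp hq hr hs; apply/is_derive_row4P => i; rewrite mxE.
rewrite (_ : (fun _ => _) = fun u => nth 0 [:: p u; q u; r u; s u] i); last first.
  by apply/funext => u; rewrite mxE.
by case: i => [[|[|[|[|]]]]].
Qed.

Definition sqn (u : R * R * R) : R := u.1.1 ^+ 2 + u.1.2 ^+ 2 + u.2 ^+ 2.

Lemma sqn_ge0 u : 0 <= sqn u.
Proof. by rewrite /sqn !addr_ge0 ?sqr_ge0. Qed.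

Lemma sqn1_gt0 u : 0 < sqn u + 1.
Proof. by have := sqn_ge0 u; lra. Qed.

(** The chart as a function on triples, the points of the measure space. *)
Definition st (u : R * R * R) : R4 := stereo u.1.1 u.1.2 u.2.

(** In other words |x - y|^2 = 4 |u - v|^2 / ((1 + |u|^2) (1 + |v|^2)): the
chart is conformal. *)
Lemma dot_st u v : 1 - dot (st u) (st v) =
  2 * sqn (u - v) / ((sqn u + 1) * (sqn v + 1)).
Proof.
have := sqn1_gt0 u; have := sqn1_gt0 v.
rewrite dotE /st /stereo /sqn !mxE /=.
case: u v => [[a b] c] [[a' b'] c'] /= h1 h2.
by field; rewrite !gt_eqF.
Qed.

Lemma S3_st u : S3 (st u).
Proof.
apply/S3E/eqP; rewrite eq_sym -subr_eq0 dot_st subrr /sqn /=.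
by rewrite !expr0n /= !addr0 mulr0 mul0r.
Qed.

Lemma sqn_eq0 u : sqn u = 0 -> u = 0.
Proof.
case: u => [[a b] c]; rewrite /sqn /= => h.
have : a ^+ 2 = 0 /\ b ^+ 2 = 0 /\ c ^+ 2 = 0.
  by have := sqr_ge0 a; have := sqr_ge0 b; have := sqr_ge0 c; lra.
by move=> [/eqP + [/eqP + /eqP]]; rewrite !sqrf_eq0 => /eqP -> /eqP -> /eqP ->.
Qed.

Lemma st_inj : injective st.
Proof.
move=> u v e; apply/eqP; rewrite -subr_eq0; apply/eqP/sqn_eq0.
have := dot_st u v; rewrite e (S3E _).1; last exact: S3_st.
move/esym/eqP; rewrite subrr !mulf_eq0 invr_eq0 mulf_eq0.
by rewrite (gt_eqF (sqn1_gt0 u)) (gt_eqF (sqn1_gt0 v)) pnatr_eq0 /= orbF => /eqP.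
Qed.

Lemma is_derive_stereo t (p q r : R -> R) (p' q' r' : R) :
  is_derive t (1 : R) p p' -> is_derive t (1 : R) q q' -> is_derive t (1 : R) r r' ->
  is_derive t (1 : R) (fun u => stereo (p u) (q u) (r u))
  (let n := p t ^+ 2 + q t ^+ 2 + r t ^+ 2 in
   let n' := 2 * (p t * p' + q t * q' + r t * r') in
   row4 (2 * p' / (n + 1) - 2 * p t * n' / (n + 1) ^+ 2)
        (2 * q' / (n + 1) - 2 * q t * n' / (n + 1) ^+ 2)
        (2 * r' / (n + 1) - 2 * r t * n' / (n + 1) ^+ 2)
        (2 * n' / (n + 1) ^+ 2)).
Proof.
move=> hp hq hr /=.
have sq (f : R -> R) f' : is_derive t (1 : R) f f' ->
    is_derive t (1 : R) (fun u => f u ^+ 2) (2 * (f t * f')).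
  by move=> hf; apply: is_derive_eq (is_derive_mulfun hf hf) _; ring.
have tw (f : R -> R) f' : is_derive t (1 : R) f f' ->
    is_derive t (1 : R) (fun u => 2 * f u) (2 * f').
  move=> hf; have h := is_derive_mulfun (is_derive_cst (2 : R) t 1) hf.
  by apply: is_derive_eq h _; rewrite mul0r add0r.
have hn := is_deriveD (is_deriveD (sq _ _ hp) (sq _ _ hq)) (sq _ _ hr).
have hn1 := is_deriveD hn (is_derive_cst (1 : R) t 1).
have hnm := is_deriveB hn (is_derive_cst (1 : R) t 1).
have n0 : p t ^+ 2 + q t ^+ 2 + r t ^+ 2 + 1 != 0.
  rewrite gt_eqF//; have := sqr_ge0 (p t); have := sqr_ge0 (q t).
  by have := sqr_ge0 (r t); lra.
have hi := @is_deriveV R (fun u => p u ^+ 2 + q u ^+ 2 + r u ^+ 2 + 1) t _ 1 n0 hn1.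
have h := is_derive_scale hi
  (is_derive_row4 (tw _ _ hp) (tw _ _ hq) (tw _ _ hr) hnm).
apply: is_derive_eq h _.
by apply: row4P; split; rewrite !mxE /=; rewrite /GRing.scale /= ?fctE; field.
Qed.

(** The Gram matrix is (2 / (1 + |u|^2))^2 times the identity. *)
Lemma vol_densityE a b c : vol_density a b c = (2 / (sqn (a, b, c) + 1)) ^+ 3.
Proof.
have n0 := sqn1_gt0 (a, b, c).
have d1 := is_derive1E (is_derive_stereo (is_derive_id a (1 : R))
  (is_derive_cst b a (1 : R)) (is_derive_cst c a (1 : R))).
have d2 := is_derive1E (is_derive_stereo (is_derive_cst a b (1 : R))
  (is_derive_id b (1 : R)) (is_derive_cst c b (1 : R))).
have d3 := is_derive1E (is_derive_stereo (is_derive_cst a c (1 : R))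
  (is_derive_cst b c (1 : R)) (is_derive_id c (1 : R))).
rewrite /vol_density det3E !mxE /stereo_partial /=.
rewrite d1 d2 d3 !dotE !mxE /=.
rewrite -[RHS]ger0_norm ?exprn_ge0 ?divr_ge0 ?(ltW n0)// -sqrtr_sqr; congr Num.sqrt.
rewrite /sqn /=; field; by rewrite gt_eqF.
Qed.

End Stereographic.

(** * Borel sets of three-space *)

Section Measurability.
Context {R : realType}.
Notation M := (measurableTypeR R).
Notation T3 := (M * M * M)%type.

Definition box (x : R * R * R) (r : R) : set (R * R * R) :=
  ball x.1.1 r `*` ball x.1.2 r `*` ball x.2 r.

Lemma measurable_box x r : measurable (box x r : set T3).
Proof.
have mb (y : R) : measurable (ball y r : set M).
  exact: measurable_realfun.measurable_ball.
by apply: measurableX; [apply: measurableX|].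
Qed.

Lemma rat_near (x e : R) : 0 < e -> exists q : rat, `|x - ratr q| < e.
Proof.
move=> e0; have /rat_in_itvoo[q] : x - e < x + e by lra.
by rewrite in_itv /= => /andP[h1 h2]; exists q; rewrite ltr_norml; lra.
Qed.

(** The product sigma-algebra contains the boxes with rational centres and radii
1 / (n + 1), and every open set is the union of the boxes among these that it
contains. *)
Lemma open_measurable3 (A : set (R * R * R)) : open A -> measurable (A : set T3).
Proof.
move=> oA.
pose F (i : rat * rat * rat * nat) : set (R * R * R) :=
  let b := box (ratr i.1.1.1, ratr i.1.1.2, ratr i.1.2) (i.2.+1%:R^-1) in
  if `[< b `<=` A >] then b else set0.
rewrite (_ : A = \bigcup_i F i).
  apply: countable_bigcupT_measurable => [|i]; first exact: countableP.
  by rewrite /F; case: ifP => // _; exact: measurable_box.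
apply/seteqP; split=> [x Ax|x [i _]]; last first.
  by rewrite /F; case: asboolP => // s /s.
have /nbhs_ballP[e /= e0 eA] : nbhs x A by exact: open_nbhs_nbhs.
have [n n1] : exists n : nat, 2 * n.+1%:R^-1 < e.
  have e2 : 0 < e / 2 by rewrite divr_gt0.
  have [n /= hn] := filter_ex (near_infty_natSinv_lt (PosNum e2)).
  by exists n; rewrite mulrC -ltr_pdivlMr.
have r0 : 0 < n.+1%:R^-1 :> R by rewrite invr_gt0.
have [a ha] := rat_near x.1.1 r0.
have [b hb] := rat_near x.1.2 r0.
have [c hc] := rat_near x.2 r0.
exists (a, b, c, n) => //; rewrite /F /=; case: asboolP => [_|].
  by split; [split|]; rewrite /= /ball /= distrC.
case=> y [[/= h1 h2] h3]; apply: eA.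
have tri (p q z : R) : `|p - z| < n.+1%:R^-1 -> `|z - q| < n.+1%:R^-1 -> `|p - q| < e.
  move: n1; set r := n.+1%:R^-1 => n1 k1 k2; have := ler_distD z p q; lra.
split; [split|]; [exact: (tri _ _ _ ha h1)|exact: (tri _ _ _ hb h2)|exact: (tri _ _ _ hc h3)].
Qed.

Lemma closed_measurable3 (A : set (R * R * R)) : closed A -> measurable (A : set T3).
Proof. by move/closed_openC/open_measurable3/measurableC; rewrite setCK. Qed.

Lemma subspace_continuous_measurable3 (D : set (R * R * R)) (f : R * R * R -> R) :
  measurable (D : set T3) -> {within D, continuous f} ->
  measurable_fun (D : set T3) (f : T3 -> R).
Proof.
move=> mD /continuousP cf; apply: (measurability _ (measurable_realfun.RGenOpens.measurableE R)).
move=> _ [_ [a [b ->] <-]].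
have : open (`]a, b[%classic : set R) by exact: interval_open.
move=> /cf/open_subspaceP[V oV VD].
rewrite setIC -VD.
by apply: measurableI => //; exact: open_measurable3.
Qed.

Lemma continuous_measurable3 (f : R * R * R -> R) : continuous f ->
  measurable_fun setT (f : T3 -> R).
Proof.
move=> cf; apply: subspace_continuous_measurable3 => //.
exact: continuous_subspaceT.
Qed.

End Measurability.

(** * Dyadic domination and Fubini for weakly singular kernels *)

Section SigmaFinite.
Context {R : realType}.
Notation M := (measurableTypeR R).
Notation T3 := (M * M * M)%type.
Notation mu := (@lebesgue3 R).
Local Open Scope ereal_scope.

Lemma lebesgue3_box (x : T3) (r : R) : (0 <= r)%R ->
  mu (box x r) = ((2 * r) ^+ 3)%:E.
Proof.
move=> r0.
have mb (y : R) : measurable (ball y r : set M).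
  exact: measurable_realfun.measurable_ball.
rewrite /lebesgue3 /box product_measure1E//; last by apply: measurableX.
rewrite [X in X * _]product_measure1E//.
transitivity ((r *+ 2)%:E * (r *+ 2)%:E * (r *+ 2)%:E).
  by congr (_ * _ * _); exact: lebesgue_measure_ball.
rewrite -!EFinM; congr (_%:E); ring.
Qed.

Lemma lebesgue3_sigma_finite : sigma_finite setT mu.
Proof.
exists (fun n => box (0, 0, 0)%R n%:R); last first.
  by move=> n; split; [exact: measurable_box|rewrite lebesgue3_box// ltry].
apply/seteqP; split=> // -[[a b] c] _ /=.
have [n hn] : exists n : nat, (`|a| + `|b| + `|c| < n%:R)%R.
  exists (Num.truncn (`|a| + `|b| + `|c|)).+1.
  by apply: truncnS_gt.
have := normr_ge0 a; have := normr_ge0 b; have := normr_ge0 c => c0 b0 a0.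
by exists n => //; split; [split|]; rewrite /= /ball /= sub0r normrN; lra.
Qed.

HB.instance Definition _ := Measure_isSigmaFinite.Build _ _ _ (@lebesgue3 R)
  lebesgue3_sigma_finite.
End SigmaFinite.

Section Integrability.
Context {R : realType}.
Notation M := (measurableTypeR R).
Notation T3 := (M * M * M)%type.
Notation mu := (@lebesgue3 R).
Local Open Scope ereal_scope.

Lemma measurable_triple_set1 (x : T3) : measurable ([set x] : set T3).
Proof.
case: x => [[a b] c]; rewrite (_ : [set _] = [set a] `*` [set b] `*` [set c]).
  by apply: measurableX => //; apply: measurableX.
by apply/seteqP; split=> [_ -> //|[[? ?] ?] [[/= -> ->] ->]].
Qed.

Lemma lebesgue3_set1 (x : T3) : mu [set x] = 0.
Proof.
case: x => [[a b] c]; rewrite (_ : [set _] = [set a] `*` [set b] `*` [set c]).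
  rewrite /lebesgue3 product_measure1E//; last by apply: measurableX.
  by rewrite [X in _ * X]lebesgue_measure_set1 mule0.
by apply/seteqP; split=> [_ -> //|[[? ?] ?] [[/= -> ->] ->]].
Qed.

(** A tool to dominate a function that is singular at x, or decays at infinity,
by one whose integral can be read off. *)
Definition box_series (c r : nat -> R) (x u : T3) : \bar R :=
  \sum_(k <oo) (c k * \1_(box x (r k)) u)%:E.

Section BoxSeries.
Variables (c r : nat -> R) (x : T3).
Hypothesis c0 : forall k, (0 <= c k)%R.

Let term_ge0 k u : 0 <= (c k * \1_(box x (r k)) u)%:E.
Proof. by rewrite lee_fin mulr_ge0. Qed.

Lemma box_series_ge0 u : 0 <= box_series c r x u.
Proof. by apply: nneseries_ge0 => k _ _; exact: term_ge0. Qed.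

Lemma box_series_ge k u : box x (r k) u -> (c k)%:E <= box_series c r x u.
Proof.
move=> xu; rewrite /box_series (nneseriesD1 (n := k))//; last first.
rewrite indicE mem_set// mulr1; apply: leeDl.
by apply: nneseries_ge0 => j _ _; exact: term_ge0.
Qed.

Let mterm k : measurable_fun (setT : set T3)
  ((fun u : T3 => (c k * \1_(box x (r k) : set T3) u)%:E) : T3 -> \bar R).
Proof.
apply/measurable_EFinP; apply: measurable_funM => //.
by apply: measurable_indic; exact: measurable_box.
Qed.

Lemma measurable_box_series : measurable_fun (setT : set T3) (box_series c r x : T3 -> \bar R).
Proof. exact: ge0_emeasurable_sum. Qed.

Lemma integral_box_series (C : R) : (forall k, 0 <= r k)%R ->
  (forall k, c k * (2 * r k) ^+ 3 = C / (2 ^ k.+1)%:R)%R ->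
  \int[mu]_u box_series c r x u = C%:E.
Proof.
move=> r0 h; rewrite integral_nneseries//.
rewrite (eq_eseriesr (g := fun k => (C / (2 ^ k.+1)%:R)%:E)); last first.
  move=> k _.
  under eq_integral do rewrite EFinM.
  rewrite ge0_integralZl//; last 2 first.
    by apply/measurable_EFinP/measurable_indic; exact: measurable_box.
    by rewrite lee_fin.
  rewrite integral_indic//; last exact: measurable_box.
  rewrite setIT [X in _ * X](lebesgue3_box x (r0 k)) -EFinM; congr (_%:E); exact: h.
apply/cvg_lim => //.
have := @cvg_geometric_eseries_half R C 0; rewrite expr0 divr1.
rewrite (_ : eseries _ = fun n => \sum_(0 <= k < n) (C / (2 ^ k.+1)%:R)%:E)//.
apply/funext => n; rewrite /eseries /=.
by apply: eq_bigr => k _; rewrite addn1.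
Qed.
End BoxSeries.

(** The dyadic shell of a point: powers of 4 bound squared norms, powers of 2
the sides of the boxes. *)
Lemma exists_pow4_le (x : R) : (1 <= x)%R -> exists k, (4 ^+ k <= x < 4 ^+ k.+1)%R.
Proof.
move=> x1.
have ex : exists k, (x < 4 ^+ k)%R.
  exists (Num.truncn x).+1; apply: lt_trans (truncnS_gt x) _.
  by rewrite -natrX ltr_nat ltn_expl.
case: (ex_minnP ex) => -[|k]; first by rewrite expr0 ltNge x1.
move=> hk hmin; exists k; rewrite hk andbT leNgt; apply/negP => /hmin.
by rewrite ltnn.
Qed.

(** The factor in each variable of the double integrand that is left once the
volume densities have absorbed the conformal factors of the chart. *)
Definition wt (u : R * R * R) : R := ((sqn u + 1) ^+ 2)^-1.

(** Dominates |u - v|^-2 in the unit ball around v: on the shell where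
|u - v|^-2 lies between 4^k and 4^(k+1), the k-th box contains u. *)
Definition near_series (v u : R * R * R) : \bar R :=
  box_series (fun k => 4 ^+ k.+1)%R (fun k => 2 / 2 ^+ k)%R v u.

(** Dominates (1 + |u|^2)^-2: on the shell where 1 + |u|^2 lies between 4^k
and 4^(k+1), the k-th box contains u. *)
Definition far_series (u : R * R * R) : \bar R :=
  box_series (fun k => (16 ^+ k)^-1)%R (fun k => 2 ^+ k.+1)%R 0%R u.

Lemma wt_ge0 u : (0 <= wt u)%R.
Proof. by rewrite invr_ge0 exprn_ge0// ltW// sqn1_gt0. Qed.

Lemma near_series_ge0 v u : 0 <= near_series v u.
Proof. by apply: box_series_ge0 => k; rewrite exprn_ge0. Qed.

Lemma far_series_ge0 u : 0 <= far_series u.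
Proof. by apply: box_series_ge0 => k; rewrite invr_ge0 exprn_ge0. Qed.

Lemma measurable_near_series v :
  measurable_fun (setT : set T3) (near_series v : T3 -> \bar R).
Proof. by apply: measurable_box_series => k; rewrite exprn_ge0. Qed.

Lemma measurable_far_series :
  measurable_fun (setT : set T3) (far_series : T3 -> \bar R).
Proof. by apply: measurable_box_series => k; rewrite invr_ge0 exprn_ge0. Qed.

Lemma integral_near_series v : \int[mu]_u near_series v u = (8 ^+ 3)%:E.
Proof.
apply: integral_box_series => k; first by rewrite exprn_ge0.
  by rewrite divr_ge0// exprn_ge0.
rewrite natrX (_ : 4 = 2 * 2)%R; last by ring.
rewrite !exprS exprMn; have : (2 ^+ k != 0 :> R)%R by rewrite expf_neq0.
move: (2 ^+ k)%R => z z0; by field.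
Qed.

Lemma integral_far_series : \int[mu]_u far_series u = (2 ^+ 7)%:E.
Proof.
apply: integral_box_series => k; first by rewrite invr_ge0 exprn_ge0.
  by rewrite exprn_ge0.
rewrite natrX (_ : 16 = 2 * 2 * (2 * 2))%R; last by ring.
rewrite !exprS !exprMn; have : (2 ^+ k != 0 :> R)%R by rewrite expf_neq0.
move: (2 ^+ k)%R => z z0; by field.
Qed.

Lemma sqn_lt_box (u v : R * R * R) (r : R) : (0 <= r)%R ->
  (sqn (u - v) < r ^+ 2)%R -> box v r u.
Proof.
case: u v => [[a b] c] [[a' b'] c']; rewrite /sqn /= => r0 h.
have lt (p q : R) : ((p - q) ^+ 2 < r ^+ 2)%R -> (`|q - p| < r)%R.
  by rewrite distrC -[X in (X < _)%R]real_normK ?num_real// ltr_sqr ?nnegrE.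
have ha := sqr_ge0 (a - a')%R; have hb := sqr_ge0 (b - b')%R.
have hc := sqr_ge0 (c - c')%R.
by split; [split|]; rewrite /= /ball /=; apply: lt; lra.
Qed.

Lemma wt_le_far u : (wt u)%:E <= far_series u.
Proof.
have [k /andP[k1 k2]] : exists k, (4 ^+ k <= sqn u + 1 < 4 ^+ k.+1)%R.
  by apply: exists_pow4_le; rewrite lerDr sqn_ge0.
apply: le_trans (box_series_ge _ (k := k) _) => [|j|]; last 2 first.
- by rewrite invr_ge0 exprn_ge0.
- apply: sqn_lt_box; first by rewrite exprn_ge0.
  rewrite subr0 -exprM mulnC exprM (_ : 2 ^+ 2 = 4)%R; last by ring.
  by apply: lt_trans k2; lra.
rewrite lee_fin /wt lef_pV2 ?posrE ?exprn_gt0 ?sqn1_gt0//.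
rewrite (_ : 16 = 4 ^+ 2)%R; last by ring.
by rewrite -exprM mulnC exprM ler_sqr ?nnegrE ?exprn_ge0// ltW// sqn1_gt0.
Qed.

(** Close to v the factor wt is at most 1 and the singularity counts; away from
v the singular factor is at most 1 and the decay of wt counts. *)
Lemma wt_div_sqn_le v u : u <> v ->
  (wt u / sqn (u - v))%:E <= near_series v u + far_series u.
Proof.
move=> uv; have q0 : (0 < sqn (u - v))%R.
  rewrite lt0r sqn_ge0 andbT; apply/eqP => /sqn_eq0/eqP.
  by rewrite subr_eq0 => /eqP.
have wt1 : (wt u <= 1)%R.
  rewrite /wt invf_le1 ?exprn_gt0 ?sqn1_gt0// exprn_ege1//.
  by rewrite lerDr sqn_ge0.
have [q1|q1] := leP 1%R (sqn (u - v)%R).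
  rewrite -[leLHS]add0e; apply: leeD; first exact: near_series_ge0.
  apply: le_trans (wt_le_far u); rewrite lee_fin ler_pdivrMr//.
  by rewrite ler_peMr// wt_ge0.
have [k /andP[k1 k2]] : exists k, (4 ^+ k <= (sqn (u - v))^-1 < 4 ^+ k.+1)%R.
  by apply: exists_pow4_le; rewrite invf_ge1// ltW.
rewrite -[leLHS]adde0; apply: leeD; last exact: far_series_ge0.
apply: le_trans (box_series_ge _ (k := k) _) => [|j|]; last 2 first.
- by rewrite exprn_ge0.
- apply: sqn_lt_box; first by rewrite divr_ge0// exprn_ge0.
  rewrite expr_div_n -exprM mulnC exprM (_ : 2 ^+ 2 = 4)%R; last by ring.
  apply: (@le_lt_trans _ _ (4 ^+ k)^-1%R).
    by rewrite -[leLHS]invrK lef_pV2 ?posrE ?exprn_gt0 ?invr_gt0.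
  by rewrite ltr_pMl ?invr_gt0 ?exprn_gt0// ltr1n.
rewrite lee_fin (le_trans _ (ltW k2))// ler_pdivrMr// mulVf ?gt_eqF//.
Qed.

(** The bound on the kernel integrates to const * wt v in u, uniformly in the
position of the singularity, and wt is itself integrable. *)
Section FubiniKernel.
Variables (F : T3 -> T3 -> R) (C : R).
Hypothesis mF : measurable_fun (setT : set (T3 * T3)) ((fun p => F p.1 p.2) : T3 * T3 -> R).
Hypothesis F_le : forall u v,
  (`|F u v|)%:E <= (C * wt v)%:E * (near_series v u + far_series u).
Hypothesis C0 : (0 <= C)%R.

Let mEF : measurable_fun (setT : set (T3 * T3)) ((fun p => (F p.1 p.2)%:E) : T3 * T3 -> \bar R).
Proof. exact/measurable_EFinP. Qed.

Let msec v : measurable_fun (setT : set T3) ((fun u => (F u v)%:E) : T3 -> \bar R).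
Proof. exact: (measurableT_comp mEF (pair2_measurable v)). Qed.

Let sec_le v : \int[mu]_u `|(F u v)%:E| <= (C * (8 ^+ 3 + 2 ^+ 7))%:E * (wt v)%:E.
Proof.
apply: (@le_trans _ _ (\int[mu]_u ((C * wt v)%:E * (near_series v u + far_series u)))).
  apply: ge0_le_integral => //.
  - exact: measurableT_comp (msec v).
  - apply: measurable_funeM; apply: emeasurable_funD.
      exact: measurable_near_series.
    exact: measurable_far_series.
  - by move=> u _; exact: F_le.
rewrite ge0_integralZl//; last 3 first.
- apply: emeasurable_funD.
    exact: measurable_near_series.
  exact: measurable_far_series.
- by move=> u _; apply: adde_ge0; [exact: near_series_ge0|exact: far_series_ge0].
- by rewrite lee_fin mulr_ge0// wt_ge0.
rewrite ge0_integralD//; last 4 first.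
- by move=> u _; exact: near_series_ge0.
- exact: measurable_near_series.
- by move=> u _; exact: far_series_ge0.
- exact: measurable_far_series.
rewrite integral_near_series integral_far_series.
rewrite -EFinD -!EFinM lee_fin mulrAC lexx//.
Qed.

Lemma kernel_section_integrable v : mu.-integrable setT (fun u => (F u v)%:E).
Proof.
apply/integrableP; split; first exact: msec.
by apply: le_lt_trans (sec_le v) _; rewrite -EFinM ltry.
Qed.

Lemma kernel_fubini :
  \int[mu]_v \int[mu]_u (F u v)%:E = \int[mu]_u \int[mu]_v (F u v)%:E.
Proof.
apply/esym; apply: (@Fubini _ _ T3 T3 R mu mu (fun p => (F p.1 p.2)%:E)).
apply/(integrable21ltyP mu mu) => //=.
apply: (@le_lt_trans _ _ (\int[mu]_v ((C * (8 ^+ 3 + 2 ^+ 7))%:E * far_series v))).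
  apply: ge0_le_integral => //.
  - by move=> v _; apply: integral_ge0.
  - apply: (@measurable_fun_fubini_tonelli_G _ _ T3 T3 R mu (fun p => `|(F p.1 p.2)%:E|)) => //.
    exact: measurableT_comp mEF.
  - by apply: measurable_funeM; exact: measurable_far_series.
  - move=> v _; apply: le_trans (sec_le v) _; apply: lee_wpmul2l => //.
      by rewrite lee_fin mulr_ge0.
    exact: wt_le_far.
rewrite ge0_integralZl//; last 3 first.
- exact: measurable_far_series.
- by move=> u _; exact: far_series_ge0.
- by rewrite lee_fin mulr_ge0.
by rewrite integral_far_series -EFinM ltry.
Qed.

End FubiniKernel.
End Integrability.

(** * The sphere and vector fields in the chart *)

Section FieldsInChart.
Context {R : realType}.
Notation R4 := ('rV[R]_4).
Notation M := (measurableTypeR R).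
Notation T3 := (M * M * M)%type.

Lemma continuous_row (T : topologicalType) (f : T -> R4) (u : T) :
  (forall i, {for u, continuous (fun x => f x 0 i)}) -> {for u, continuous f}.
Proof.
move=> h; apply/cvg_ballP => e e0.
have hi i : \forall x \near u, ball (f u 0 i) e (f x 0 i).
  by have /cvg_ballP := h i; exact.
have : \forall x \near u, forall i : 'I_4, ball (f u 0 i) e (f x 0 i).
  by apply: filter_forall => i; exact: hi.
rewrite near_map; apply: filterS => x hx.
by split=> // i j; rewrite (ord1 i).
Qed.

Lemma continuous_triple1 : continuous (fun x : R * R * R => x.1.1).
Proof.
by move=> x; apply: (continuous_comp (f := fst) (g := fst)); exact: cvg_fst.
Qed.

Lemma continuous_triple2 : continuous (fun x : R * R * R => x.1.2).
Proof.
move=> x; apply: (continuous_comp (f := fst) (g := snd)); first exact: cvg_fst.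
exact: cvg_snd.
Qed.

Lemma continuous_triple3 : continuous (fun x : R * R * R => x.2).
Proof. by move=> x; exact: cvg_snd. Qed.

Lemma continuous_sqn : continuous (@sqn R).
Proof.
move=> u.
have sq (f : R * R * R -> R) : continuous f -> {for u, continuous (fun x => f x ^+ 2)}.
  by move=> cf; apply: (continuous_comp (g := fun y : R => y ^+ 2) (cf u)); exact: exprn_continuous.
have c12 : {for u, continuous (fun x : R * R * R => x.1.1 ^+ 2 + x.1.2 ^+ 2)}.
  apply: continuousD; apply: sq.
    exact: continuous_triple1.
  exact: continuous_triple2.
exact: (continuousD c12 (sq _ continuous_triple3)).
Qed.

Lemma continuous_st : continuous (@st R).
Proof.
move=> u.
have cn : {for u, continuous (fun x => (sqn x + 1)^-1)}.
  apply: continuousV; first by rewrite gt_eqF// sqn1_gt0.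
  by apply: continuousD; [exact: continuous_sqn|exact: cst_continuous].
apply: continuous_row => i.
pose f j (x : R * R * R) : R := nth 0 [:: 2 * x.1.1; 2 * x.1.2; 2 * x.2; sqn x - 1] j.
rewrite (_ : (fun _ => _) = fun x => (sqn x + 1)^-1 * f i x); last first.
  by apply/funext => x; rewrite /st /stereo !mxE.
apply: continuousM => //; rewrite /f.
case: i => [[|[|[|[|//]]]] _] /=.
- by apply: continuousM; [exact: cst_continuous|exact: continuous_triple1].
- by apply: continuousM; [exact: cst_continuous|exact: continuous_triple2].
- by apply: continuousM; [exact: cst_continuous|exact: continuous_triple3].
- by apply: continuousB; [exact: continuous_sqn|exact: cst_continuous].
Qed.

Lemma compact_S3 : compact (@S3 R).
Proof.
apply: bounded_closed_compact.
  exists 1; split; first exact: num_real.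
  move=> r r1 x /S3E xx; rewrite /Num.Def.normr /= mx_normrE.
  apply: bigmax_le => [|[i j] _]; first by lra.
  rewrite (ord1 i) (le_trans _ (ltW r1))//= -sqrtr_sqr -[leRHS]sqrtr1.
  by rewrite ler_sqrt// -xx coord_sqr_le.
rewrite (_ : S3 = (fun x => dot x x) @^-1` [set 1]); last first.
  by apply/seteqP; split => x /S3E.
apply: preimage_closed; last exact: closed_eq.
by move=> x _; apply: continuous_dot; exact: cvg_id.
Qed.

(** Near each point of A the field is the restriction of a smooth map. *)
Lemma smooth_on_continuous (A : set R4) (V : R4 -> R4) : smooth_on A V ->
  {within A, continuous V}.
Proof.
move=> sV; apply/subspace_continuousP => a Aa.
have [U [g [oO Oa sg gV]]] := sV a Aa.
have ctg : {for a, continuous g} by exact: (sg 0%N).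
rewrite /from_subspace /= -(gV _ Aa Oa).
have : g x @[x --> within A (nbhs a)] --> g a.
  exact: cvg_within_filter.
apply: cvg_trans; apply: near_eq_cvg.
rewrite near_withinE.
have : nbhs a U by exact: open_nbhs_nbhs.
by apply: filterS => x Ox Ax; exact: gV.
Qed.

Lemma compact_field_bounded (A : set R4) (V : R4 -> R4) : compact A ->
  {within A, continuous V} ->
  exists2 B, 0 <= B & forall x i, A x -> `|V x 0 i| <= B.
Proof.
move=> cA cV; have [B [_ hB]] := compact_bounded (continuous_compact cV cA).
exists (`|B| + 1); first by rewrite addr_ge0.
move=> x i Ax; have : `|V x| <= `|B| + 1.
  by apply: hB; [have := ler_norm B; lra|exists x].
apply: le_trans; rewrite [leRHS]/Num.Def.normr /= mx_normrE.
by apply: le_trans; last exact: (le_bigmax _ _ (0, i)).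
Qed.

(** Extended by 0, so that integrals over a part of the sphere become integrals
over the whole coordinate space. *)
Definition chart_field (A : set R4) (V : R4 -> R4) (u : R * R * R) : R4 :=
  if `[< A (st u) >] then V (st u) else 0.

Lemma measurable_chart_domain (A : set R4) : closed A ->
  measurable (@st R @^-1` A : set T3).
Proof.
move=> cA; apply: closed_measurable3; apply: preimage_closed => // x _.
exact: continuous_st.
Qed.

Lemma measurable_chart_field (A : set R4) (V : R4 -> R4) i : closed A ->
  {within A, continuous V} ->
  measurable_fun (setT : set T3) ((fun u => chart_field A V u 0 i) : T3 -> R).
Proof.
move=> cA cV; have mD := measurable_chart_domain cA.
rewrite (_ : (fun _ => _) = (fun u => V (st u) 0 i) \_ (@st R @^-1` A)); last first.
  apply/funext => u; rewrite /chart_field patchE.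
  case: asboolP => h; first by rewrite mem_set.
  by rewrite memNset// mxE.
apply: (measurable_restrictT _ _).1 => //.
apply: subspace_continuous_measurable3 => //.
apply/subspace_continuousP => u Au.
have cVu : V x @[x --> within A (nbhs (st u))] --> V (st u).
  by move/subspace_continuousP : cV => /(_ _ Au).
have h : V (st x) @[x --> within (@st R @^-1` A) (nbhs u)] --> V (st u).
  move=> P /cVu hP.
  have hw : nbhs (st u) [set x | A x -> P (V x)] by [].
  exact: (continuous_st hw).
exact: (cvg_comp _ _ h (@coord_continuous R 1 4 0 i (V (st u)))).
Qed.

End FieldsInChart.

(** * The integrand in the chart *)

Section Kernel.
Context {R : realType}.
Notation R4 := ('rV[R]_4).
Notation M := (measurableTypeR R).
Notation T3 := (M * M * M)%type.
Notation mu := (@lebesgue3 R).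
Implicit Types (V W : R * R * R -> R4) (u v : R * R * R).

Definition vold (u : R * R * R) : R := (2 / (sqn u + 1)) ^+ 3.

Lemma vold_gt0 u : 0 < vold u.
Proof. by rewrite exprn_gt0// divr_gt0// sqn1_gt0. Qed.

(** The value 0 outside the open interval makes the kernel vanish on the
diagonal and the antidiagonal, where kappa has no meaning. *)
Definition kappa0 (s : R) : R := if s \in `](-1), 1[ then kappa s else 0.

(** The density in u of the Biot-Savart integral of V at the point of coordinate
v, paired with W there.  The two fields are given in the chart. *)
Definition kern (V W : R * R * R -> R4) (u v : R * R * R) : R :=
  kappa0 (dot (st u) (st v)) * dot (cross (st v) (V u) (st u)) (W v) * vold u.

(** The symmetry of the determinant: this is self-adjointness at the level of
integrands. *)
Lemma kern_swap V W u v : kern W V u v * vold v = kern V W v u * vold u.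
Proof.
rewrite /kern dot_cross_swap (dotC (W u)) (dotC (st u) (st v)).
by rewrite mulrAC.
Qed.

Lemma dot_le (x y : R4) (A B : R) : (forall i, `|x 0 i| <= A) ->
  (forall i, `|y 0 i| <= B) -> `|dot x y| <= 4 * (A * B).
Proof.
move=> hx hy; apply: le_trans (ler_norm_sum _ _ _) _.
rewrite (_ : 4 * (A * B) = \sum_(i < 4) (A * B)); last first.
  by rewrite sumr_const card_ord mulr_natl.
by apply: ler_sum => i _; rewrite normrM ler_pM.
Qed.

(** With s = <x, y>, 1 / (1 - s) = (1 + |u|^2) (1 + |v|^2) / (2 |u - v|^2), and the two
volume densities turn the numerator into wt u * wt v. *)
Lemma kern_le V W (BV BW : R) u v : 0 <= BV -> 0 <= BW ->
  (forall u i, `|V u 0 i| <= BV) -> (forall u i, `|W u 0 i| <= BW) ->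
  ((`|kern V W u v * vold v|)%:E <=
   ((24 * (BV * BW) * 32) * wt v)%:E * (near_series v u + far_series u))%E.
Proof.
move=> BV0 BW0 hV hW.
have c0 : 0 <= 24 * (BV * BW) * 32 by rewrite !mulr_ge0.
have rhs0 : (0 <= ((24 * (BV * BW) * 32) * wt v)%:E * (near_series v u + far_series u))%E.
  apply: mule_ge0; first by rewrite lee_fin mulr_ge0// wt_ge0.
  by apply: adde_ge0; [exact: near_series_ge0|exact: far_series_ge0].
rewrite /kern /kappa0; set s := dot _ _; case: ifPn => [|_]; last first.
  by rewrite !mul0r normr0.
rewrite in_itv /= => hs.
have uv : u <> v.
  move=> uv; move: hs; rewrite /s uv (S3E _).1; last exact: S3_st.
  by rewrite ltxx andbF.
have Su := S3_st u; have Sv := S3_st v.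
have n0 := sqn1_gt0 u; have n'0 := sqn1_gt0 v.
have q0 : 0 < sqn (u - v).
  by rewrite lt0r sqn_ge0 andbT; apply/eqP => /sqn_eq0/eqP; rewrite subr_eq0 => /eqP.
have := wt_div_sqn_le uv.
move=> /(lee_wpmul2l (x := (24 * (BV * BW) * 32 * wt v)%:E)).
rewrite lee_fin mulr_ge0// ?wt_ge0// => /(_ isT); apply: le_trans.
rewrite -EFinM lee_fin normrM (gtr0_norm (vold_gt0 v)).
rewrite normrM (gtr0_norm (vold_gt0 u)) normrM.
have w0 := sqrt_1Bsqr_gt0 hs; set w := Num.sqrt _ in w0.
have hd : `|dot (cross (st v) (V u) (st u)) (W v)| <= 4 * ((6 * BV * w) * BW).
  by apply: dot_le => // i; apply: cross_coord_le_sin.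
have hk := kappa_le hs; rewrite -/w in hk.
have e : (1 - s)^-1 = (sqn u + 1) * (sqn v + 1) / (2 * sqn (u - v)).
  by rewrite dot_st invf_div.
apply: (@le_trans _ _ (24 * (BV * BW) * (1 - s)^-1 * vold u * vold v)).
  rewrite !ler_pM2r ?vold_gt0//.
  apply: le_trans (ler_wpM2l (normr_ge0 _) hd) _.
  apply: le_trans (ler_wpM2l _ hk); last by rewrite !mulr_ge0.
  by rewrite le_eqVlt; apply/orP; left; apply/eqP; ring.
rewrite e /vold /wt le_eqVlt; apply/orP; left; apply/eqP; field.
by rewrite !gt_eqF.
Qed.

Lemma measurable_kappa :
  measurable_fun (`](-1), 1[%classic : set R) (@kappa R).
Proof.
apply: open_continuous_measurable_fun; first exact: interval_open.
move=> s; rewrite inE /= in_itv /= => hs.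
have w0 := sqrt_1Bsqr_gt0 hs.
have cw : {for s, continuous (fun s : R => Num.sqrt (1 - s ^+ 2))}.
  apply: (continuous_comp (f := fun s : R => 1 - s ^+ 2)); last exact: sqrt_continuous.
  by apply: continuousB; [exact: cst_continuous|exact: exprn_continuous].
have cw3 : {for s, continuous (fun s : R => (Num.sqrt (1 - s ^+ 2) ^+ 3)^-1)}.
  apply: continuousV; first by rewrite expf_neq0// gt_eqF.
  by apply: (continuous_comp (g := fun y : R => y ^+ 3) cw); exact: exprn_continuous.
have cn : {for s, continuous (fun s : R => Num.sqrt (1 - s ^+ 2) + (pi - acos s) * s)}.
  apply: continuousD; first exact: cw.
  apply: continuousM; last exact: cvg_id.
  by apply: continuousB; [exact: cst_continuous|exact: continuous_acos].
have c4 : {for s, continuous (fun=> - (4 * pi ^+ 2)^-1 : R)} by exact: cst_continuous.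
exact: (continuousM c4 (continuousM cn cw3)).
Qed.

Lemma measurable_kappa0 : measurable_fun setT kappa0.
Proof.
rewrite (_ : kappa0 = (@kappa R) \_ `](-1), 1[); last first.
  by apply/funext => s; rewrite /kappa0 patchE mem_setE.
by apply: (measurable_restrictT _ _).1 => //; exact: measurable_kappa.
Qed.

Lemma measurable_vold : measurable_fun (setT : set T3) (vold : T3 -> R).
Proof.
apply: continuous_measurable3 => u.
have c : {for u, continuous (fun x : R * R * R => 2 / (sqn x + 1))}.
  apply: continuousM; first exact: cst_continuous.
  apply: continuousV; first by rewrite gt_eqF// sqn1_gt0.
  by apply: continuousD; [exact: continuous_sqn|exact: cst_continuous].
by apply: (continuous_comp (g := fun y : R => y ^+ 3) c); exact: exprn_continuous.
Qed.

Lemma measurable_st i : measurable_fun (setT : set T3) ((fun u => st u 0 i) : T3 -> R).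
Proof.
apply: continuous_measurable3 => u.
exact: (continuous_comp (@continuous_st R u) (@coord_continuous R 1 4 0 i _)).
Qed.

Lemma measurable_kern V W :
  (forall i, measurable_fun (setT : set T3) ((fun u => V u 0 i) : T3 -> R)) ->
  (forall i, measurable_fun (setT : set T3) ((fun u => W u 0 i) : T3 -> R)) ->
  measurable_fun (setT : set (T3 * T3))
    ((fun p => kern V W p.1 p.2 * vold p.2) : T3 * T3 -> R).
Proof.
move=> mV mW.
have c1 (f : T3 -> R) : measurable_fun setT f ->
    measurable_fun (setT : set (T3 * T3)) ((fun p => f p.1) : T3 * T3 -> R).
  by move=> mf; apply: (measurableT_comp mf); exact: measurable_fst.
have c2 (f : T3 -> R) : measurable_fun setT f ->
    measurable_fun (setT : set (T3 * T3)) ((fun p => f p.2) : T3 * T3 -> R).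
  by move=> mf; apply: (measurableT_comp mf); exact: measurable_snd.
have mV1 i := c1 _ (mV i); have mW2 i := c2 _ (mW i).
have ms1 i := c1 _ (measurable_st i); have ms2 i := c2 _ (measurable_st i).
apply: measurable_funM; last exact: (c2 _ measurable_vold).
apply: measurable_funM; last exact: (c1 _ measurable_vold).
apply: measurable_funM.
  apply: (measurableT_comp measurable_kappa0).
  rewrite (_ : (fun _ => _) = fun p : T3 * T3 => st p.1 0 0 * st p.2 0 0 + st p.1 0 1 * st p.2 0 1 +
    st p.1 0 2%:R * st p.2 0 2%:R + st p.1 0 3%:R * st p.2 0 3%:R); last first.
    by apply/funext => p; rewrite dotE.
  by do !apply: measurable_funD; apply: measurable_funM.
pose mf (f : T3 * T3 -> R) := measurable_fun (setT : set (T3 * T3)) f.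
have addm f g : mf f -> mf g -> mf (fun p => f p + g p) by exact: measurable_funD.
have mulm f g : mf f -> mf g -> mf (fun p => f p * g p) by exact: measurable_funM.
have oppm f : mf f -> mf (fun p => - f p).
  by move=> h; apply: (measurableT_comp (@oppr_measurable R setT) h).
have mc j : mf (fun p => cross (st p.2) (V p.1) (st p.1) 0 j).
  exact: (cross_coord_closed (P := mf)).
rewrite (_ : (fun _ => _) = fun p : T3 * T3 =>
  cross (st p.2) (V p.1) (st p.1) 0 0 * W p.2 0 0 +
  cross (st p.2) (V p.1) (st p.1) 0 1 * W p.2 0 1 +
  cross (st p.2) (V p.1) (st p.1) 0 2%:R * W p.2 0 2%:R +
  cross (st p.2) (V p.1) (st p.1) 0 3%:R * W p.2 0 3%:R); last first.
  by apply/funext => p; rewrite dotE.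
by apply: (addm _ _); [apply: (addm _ _); [apply: (addm _ _)|]|];
  apply: (mulm _ _); first [exact: mc | exact: mW2].
Qed.

End Kernel.

(** * Self-adjointness *)

Section Assembly.
Context {R : realType}.
Notation R4 := ('rV[R]_4).
Notation M := (measurableTypeR R).
Notation T3 := (M * M * M)%type.
Notation mu := (@lebesgue3 R).
Implicit Types (V W : R * R * R -> R4) (u v : R * R * R).

(** The integrand in the definition of the Biot-Savart operator has unspecified
values at two points, removed one at a time; they affect neither
measurability nor the integral. *)
Lemma Rintegral_modify1 (f g : T3 -> R) (x : T3) :
  measurable_fun setT g -> (forall u, u <> x -> f u = g u) ->
  measurable_fun setT f /\ \int[mu]_u f u = \int[mu]_u g u.
Proof.
move=> mg fg.
have mx : measurable ([set x] : set T3) := measurable_triple_set1 x.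
have mf : measurable_fun setT f.
  rewrite -(setvU [set x]); apply/measurable_funU => //; first exact: measurableC.
  split; last exact: measurable_fun_set1.
  apply: (eq_measurable_fun g); last exact: measurable_funTS.
  by move=> u; rewrite inE /= => ux; rewrite fg.
split=> //; rewrite /Rintegral; congr fine.
apply: ae_eq_integral => //; [exact/measurable_EFinP|exact/measurable_EFinP|].
exists [set x]; split => //; first exact: lebesgue3_set1.
move=> u /= h; apply: contrapT => ux; apply: h => _; congr (_%:E).
exact: fg.
Qed.

Section BoundedFields.
Variables (V W : T3 -> R4) (BV BW : R).
Hypotheses (BV0 : 0 <= BV) (BW0 : 0 <= BW).
Hypotheses (hV : forall u i, `|V u 0 i| <= BV) (hW : forall u i, `|W u 0 i| <= BW).
Hypothesis mV : forall i, measurable_fun (setT : set T3) ((fun u => V u 0 i) : T3 -> R).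
Hypothesis mW : forall i, measurable_fun (setT : set T3) ((fun u => W u 0 i) : T3 -> R).

Let mF := measurable_kern mV mW.
Let F_le (u v : T3) := kern_le u v BV0 BW0 hV hW.
Let C0 : 0 <= 24 * (BV * BW) * 32.
Proof. by rewrite !mulr_ge0. Qed.

Lemma kern_fubini :
  (\int[mu]_v \int[mu]_u (kern V W u v * vold v)%:E =
   \int[mu]_u \int[mu]_v (kern V W u v * vold v)%:E)%E.
Proof. exact: (kernel_fubini (F := fun u v => kern V W u v * vold v) mF F_le C0). Qed.

Lemma kern_vold_integrable (v : T3) :
  mu.-integrable setT (fun u => (kern V W u v * vold v)%:E).
Proof.
exact: (kernel_section_integrable (F := fun u v => kern V W u v * vold v) mF F_le C0).
Qed.

Lemma kern_integrable (v : T3) : mu.-integrable setT (fun u => (kern V W u v)%:E).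
Proof.
have h := integrableZl measurableT (vold v)^-1 (kern_vold_integrable v).
rewrite (_ : (fun _ => _) = (fun u => ((vold v)^-1)%:E * (kern V W u v * vold v)%:E)%E) //.
apply/funext => u; rewrite -EFinM; congr (_%:E).
by rewrite mulrCA mulVf ?mulr1// gt_eqF// vold_gt0.
Qed.

End BoundedFields.

Lemma dot_delta (x : R4) j : dot x (delta_mx 0 j) = x 0 j.
Proof.
rewrite /dot (bigD1 j) //= big1 ?addr0 ?mxE ?eqxx ?mulr1// => i ij.
by rewrite mxE /= (negPf ij) mulr0.
Qed.

Lemma cross0v (a c : R4) : cross a 0 c = 0.
Proof. by rewrite crossE; apply: row4P; split; rewrite !mxE /=; ring. Qed.

(** The two formulas for the integrand agree except possibly at the coordinates
of st v and of its antipode, the latter being missing when st v is the south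
pole, whose antipode is the pole of projection. *)
Lemma BS_chart (A : set R4) (V : R4 -> R4) (v : T3) j :
  (forall x, A x -> tangent x (V x)) ->
  (forall i, measurable_fun (setT : set T3) ((fun u => chart_field A V u 0 i) : T3 -> R)) ->
  BS A V (st v) 0 j = \int[mu]_u kern (chart_field A V) (fun=> delta_mx 0 j) u v.
Proof.
move=> tV mV; rewrite /BS /vintS3 mxE /intS3.
pose k u := kern (chart_field A V) (fun=> delta_mx 0 j) u v.
rewrite Rintegral_mkcond; set f := _ \_ _.
have mk : measurable_fun (setT : set T3) (k : T3 -> R).
  have m1 i : measurable_fun (setT : set T3) ((fun u => (delta_mx 0 j : R4) 0 i) : T3 -> R).
    exact: measurable_cst.
  have := measurableT_comp (measurable_kern mV m1) (pair2_measurable (v : T3)).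
  move=> /(measurable_funM (@measurable_cst _ _ T3 R setT (vold v)^-1)).
  rewrite (_ : (_ \* _) = k)//; apply/funext => u /=.
  by rewrite mulrCA mulVf ?mulr1// gt_eqF// vold_gt0.
have fk u : u <> v -> st u <> - st v -> f u = k u.
  move=> uv uNv; rewrite /f patchE /k /kern /chart_field.
  case: asboolP => Au; last by rewrite memNset// cross0v (dotC 0) dot0r mulr0 mul0r.
  rewrite mem_set// biot_savart_kernelE; [|exact: S3_st|exact: S3_st| |exact: tV]; last first.
    by apply: dot_S3_itvoo => //; [exact: S3_st|exact: S3_st|move=> /st_inj].
  rewrite dot_delta mxE /kappa0 -/(st u) vol_densityE ifT//.
  by rewrite in_itv; apply: dot_S3_itvoo => //; [exact: S3_st|exact: S3_st|move=> /st_inj].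
have [[w sw]|nw] := pselect (exists w : T3, st w = - st v).
  pose g u := if pselect (u = w) then f u else k u.
  have gk u : u <> w -> g u = k u by rewrite /g; case: pselect.
  have [mg <-] := Rintegral_modify1 mk gk.
  have fg u : u <> v -> f u = g u.
    move=> uv; rewrite /g; case: pselect => // uw; apply: fk => // uNv.
    by apply: uw; apply: st_inj; rewrite uNv.
  by have [] := Rintegral_modify1 mg fg.
have fk' u : u <> v -> f u = k u.
  by move=> uv; apply: fk => // uNv; apply: nw; exists u.
by have [] := Rintegral_modify1 mk fk'.
Qed.

(** The integral over u converges absolutely for every v, so the scalar product
with W v can be moved under the integral sign coordinate by coordinate. *)
Lemma L2prod_BS_chart (A : set R4) (V W : R4 -> R4) (BV BW : R) :
  0 <= BV -> 0 <= BW ->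
  (forall x, A x -> tangent x (V x)) ->
  (forall u i, `|chart_field A V u 0 i| <= BV) ->
  (forall u i, `|chart_field A W u 0 i| <= BW) ->
  (forall i, measurable_fun (setT : set T3) ((fun u => chart_field A V u 0 i) : T3 -> R)) ->
  (forall i, measurable_fun (setT : set T3) ((fun u => chart_field A W u 0 i) : T3 -> R)) ->
  L2prod A (BS A V) W = fine (\int[mu]_v \int[mu]_u
    (kern (chart_field A V) (chart_field A W) u v * vold v)%:E)%E.
Proof.
move=> BV0 BW0 tV hV hW mV mW.
have dle j (u : T3) i : `|(delta_mx 0 j : R4) 0 i| <= 1.
  by rewrite mxE /= normr_nat lern1 leq_b1.
have intj (v : T3) j : mu.-integrable setT
    (fun u => (kern (chart_field A V) (fun=> delta_mx 0 j) u v)%:E).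
  apply: (@kern_integrable (chart_field A V) (fun=> delta_mx 0 j) BV 1) => //.
  exact: dle.
have inner (v : T3) : dot (BS A V (st v)) (chart_field A W v) =
    \int[mu]_u kern (chart_field A V) (chart_field A W) u v.
  rewrite dotE !(BS_chart _ _ tV mV).
  pose kj j u := kern (chart_field A V) (fun=> delta_mx 0 j) u v.
  pose Wv := chart_field A W v.
  have ij j : mu.-integrable setT (EFin \o (fun u => kj j u * Wv 0 j)).
    rewrite (_ : _ \o _ = (fun u => (kj j u)%:E * (Wv 0 j)%:E)%E)//.
    by apply: integrableZr => //; exact: intj.
  rewrite -!RintegralZr//; [|exact: intj..].
  have ijD (f g : T3 -> R) : mu.-integrable setT (EFin \o f) ->
      mu.-integrable setT (EFin \o g) ->
      mu.-integrable setT (EFin \o (fun u => f u + g u)).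
    by move=> intf intg; exact: (integrableD measurableT intf intg).
  rewrite -!RintegralD//.
  all: try by do ?[exact: ij | apply: (ijD _ _)].
  apply: eq_Rintegral => u _; rewrite /kj /kern !dot_delta [X in _ = _ * X * _]dotE -/Wv; ring.
rewrite /L2prod /intS3 Rintegral_mkcond.
rewrite /Rintegral; congr fine; apply: eq_integral => v _.
have hv := @kern_vold_integrable _ _ BV BW BV0 BW0 hV hW mV mW v.
have hk := @kern_integrable _ _ BV BW BV0 BW0 hV hW mV mW v.
under eq_integral do rewrite EFinM.
rewrite integralZr// -(fineK (integrable_fin_num measurableT hk)) -EFinM; congr (_%:E).
rewrite -[fine _]/(\int[mu]_u kern (chart_field A V) (chart_field A W) u v) -inner.
rewrite patchE /chart_field; case: asboolP => Av.
  by rewrite mem_set// -/(st v) vol_densityE.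
by rewrite memNset// dot0r mul0r.
Qed.

End Assembly.

Theorem proposition4p7 (R : realType) (Omega : set 'rV[R]_4)
    (hOmega : subdomain Omega \/ Omega = S3)
    (V W : 'rV[R]_4 -> 'rV[R]_4) (hV : VF Omega V) (hW : VF Omega W) :
  L2prod Omega (BS Omega V) W = L2prod Omega V (BS Omega W).
Proof.
have cO : compact Omega by case: hOmega => [[]//|->]; exact: compact_S3.
have clO : closed Omega by apply: compact_closed => //; exact: norm_hausdorff.
have [sV tV] := hV; have [sW tW] := hW.
have cV := smooth_on_continuous sV; have cW := smooth_on_continuous sW.
have mV i := measurable_chart_field i clO cV.
have mW i := measurable_chart_field i clO cW.
have bounded (X : 'rV[R]_4 -> 'rV[R]_4) : {within Omega, continuous X} ->
    exists2 B, 0 <= B & forall u i, `|chart_field Omega X u 0 i| <= B.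
  move=> cX; have [B B0 hB] := compact_field_bounded cO cX.
  exists B => // u i; rewrite /chart_field; case: asboolP => [Ou|_].
    exact: hB.
  by rewrite mxE normr0.
have [BV BV0 bV] := bounded V cV; have [BW BW0 bW] := bounded W cW.
have -> : L2prod Omega V (BS Omega W) = L2prod Omega (BS Omega W) V.
  by rewrite /L2prod; congr intS3; apply/funext => x; rewrite dotC.
rewrite (L2prod_BS_chart BV0 BW0 tV bV bW mV mW).
rewrite (L2prod_BS_chart BW0 BV0 tW bW bV mW mV).
rewrite (kern_fubini BV0 BW0 bV bW mV mW); congr fine.
by apply: eq_integral => u _; apply: eq_integral => v _; rewrite kern_swap.
Qed.
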